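(* Let $(T,d)$ be a compact metric space, $\Sigma$ its Borel $\sigma$-algebra, $\mu:\Sigma\to[0,\infty)$ a regular, countably additive, pointwise non atomic measure, and $X$ a Banach space. Let $i:cwk(X)\to C(\Omega)$ be the embedding described in the context, and let $F:T\to cwk(X)$ be a multifunction. The following are equivalent: (1) $F$ is H-integrable; (2) the function $i(F):T\to C(\Omega)$, $t\mapsto i(F(t))$, is H-integrable; and in that case $\mathrm{(H)}\int_T i(F)\,d\mu=i(J_T(F))$, where $J_T(F)=\mathrm{(H)}\int_T F\,d\mu$; (3) for every $E\in\Sigma$ and every $\varepsilon>0$ there exists a gauge $\gamma$ such that $\|\sigma(i(F),\Pi_1)-\sigma(i(F),\Pi_2)\|_\infty\le\varepsilon$ for all $\gamma$-fine partitions $\Pi_1,\Pi_2$ of $E$; (4) $F$ is the sum of a non-negative H-integrable multifunction $G:T\to cwk(X)$ and an H-integrable single-valued function $f:T\to X$. Moreover, these statements imply: (5) the family $W_F=\{s(x^*,F):x^*\in B_{X^*}\}$ of real functions on $T$ is uniformly integrable, where $s(x^*,F)$ denotes $t\mapsto s(x^*,F(t))=\sup\{x^*(x):x\in F(t)\}$ and $B_{X^*}$ is the closed unit ball of $X^*$.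
   Context: Pointwise non atomic means $\mu(\{t\})=0$ for every $t\in T$. $cwk(X)$ is the family of all non-empty convex weakly compact subsets of $X$, with Minkowski addition and scalar multiplication; $d_H$ is the Hausdorff distance. Embedding (known theorem): there exist a compact Hausdorff space $\Omega$ and a positively linear map $i:cwk(X)\to C(\Omega)$ (i.e. additive and positively homogeneous) such that $d_H(A,C)=\|i(A)-i(C)\|_\infty$ for all $A,C\in cwk(X)$; $i(cwk(X))$ is norm closed in $C(\Omega)$; and $i(\overline{\mathrm{co}}(A\cup C))=\max\{i(A),i(C)\}$ for all $A,C\in cwk(X)$. Fix such $\Omega$ and $i$. A multifunction $G:T\to cwk(X)$ is called non-negative if $i(G(t))\ge 0$ in $C(\Omega)$ for every $t\in T$. A gauge is any map $\gamma:T\to(0,\infty)$. For $E\in\Sigma$, a partition of $E$ is a finite family $\Pi=\{(E_j,t_j):j=1,\dots,k\}$ with $t_j\in T$, $E_j\in\Sigma$, $\mu(E_j\cap E_l)=0$ for $j\ne l$, and $\bigcup_j E_j=E$ (the tags $t_j$ need not lie in $E_j$). It is $\gamma$-fine if $d(w,t_j)<\gamma(t_j)$ for every $w\in E_j$ and every $j$. For a function $f$ from $T$ to a Banach space $Y$, $\sigma(f,\Pi)=\sum_j f(t_j)\mu(E_j)$; $f$ is H-integrable with integral $I=\mathrm{(H)}\int_T f\,d\mu\in Y$ if for every $\varepsilon>0$ there is a gauge $\gamma$ with $\|\sigma(f,\Pi)-I\|\le\varepsilon$ for every $\gamma$-fine partition $\Pi$ of $T$. (Since $\mu$ is pointwise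 non atomic, requiring in addition $t_j\in E_j$ gives an equivalent notion.) A multifunction $F:T\to cwk(X)$ is H-integrable if there is $J\in cwk(X)$ such that for every $\varepsilon>0$ there is a gauge $\gamma$ with $d_H(\sum_{\Pi}F,J)\le\varepsilon$ for every $\gamma$-fine partition $\Pi=\{(E_j,t_j)\}$ of $T$, where $\sum_\Pi F=\sum_j \mu(E_j)F(t_j)$; then $J_T(F)=\mathrm{(H)}\int_T F\,d\mu:=J$. *)

(* Defs.v *)
From HB Require Import structures.
From mathcomp Require Import all_boot all_order all_algebra.
From mathcomp Require Import all_classical all_reals all_analysis.

Set Implicit Arguments.
Unset Strict Implicit.
Unset Printing Implicit Defensive.

Import Order.TTheory GRing.Theory Num.Theory.
Import numFieldNormedType.Exports.

Local Open Scope classical_set_scope.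
Local Open Scope ring_scope.

(* No relation between the distance and the sigma-algebra is built in; see
   [borel] below. *)
#[short(type="measurableMetricType")]
HB.structure Definition MeasurableMetric (d : measure_display)
    (K : numDomainType) := {T of Metric K T & Measurable d T}.

(* The proof of compactness is a parameter of the type because it is what makes
   the sup norm a norm. *)
Definition contSpace (R : realType) (Omega : topologicalType)
    (cO : compact [set: Omega]) : Type := continuousType Omega R.
Arguments contSpace : clear implicits.

Section contSpace_normedModType.
Context (R : realType) (Omega : topologicalType) (cO : compact [set: Omega]).
Local Notation C := (contSpace R Omega cO).

HB.instance Definition _ := Choice.on C.

Definition contSpace_fun (f : C) : Omega -> R := (f : continuousType Omega R).
Local Coercion contSpace_fun : contSpace >-> Funclass.

Definition contSpace_mk (f : Omega -> R) (cf : continuous f) : C :=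
  (mkcts cf : continuousType Omega R).

Lemma contSpace_mkE f cf w : @contSpace_mk f cf w = f w.
Proof. by []. Qed.

Lemma contSpace_continuous (f : C) : continuous f.
Proof. exact: cts_fun. Qed.

Lemma contSpaceP (f g : C) : (forall w, f w = g w) -> f = g.
Proof. by move=> fg; apply/continuousEP. Qed.

Fact contSpace_add_subproof (f g : C) : continuous (fun w => f w + g w).
Proof. by move=> w; apply: cvgD; exact: contSpace_continuous. Qed.

Fact contSpace_opp_subproof (f : C) : continuous (fun w => - f w).
Proof. by move=> w; apply: cvgN; exact: contSpace_continuous. Qed.

Fact contSpace_scale_subproof (r : R) (f : C) : continuous (fun w => r * f w).
Proof. by move=> w; apply: cvgMl_tmp; exact: contSpace_continuous. Qed.

Definition contSpace_zero : C := contSpace_mk (@cst_continuous Omega R 0).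
Definition contSpace_add (f g : C) : C :=
  contSpace_mk (@contSpace_add_subproof f g).
Definition contSpace_opp (f : C) : C := contSpace_mk (@contSpace_opp_subproof f).
Definition contSpace_scale (r : R) (f : C) : C :=
  contSpace_mk (@contSpace_scale_subproof r f).

Fact contSpace_addA : associative contSpace_add.
Proof. by move=> f g h; apply: contSpaceP => w; exact: addrA. Qed.
Fact contSpace_addC : commutative contSpace_add.
Proof. by move=> f g; apply: contSpaceP => w; exact: addrC. Qed.
Fact contSpace_add0 : left_id contSpace_zero contSpace_add.
Proof. by move=> f; apply: contSpaceP => w; exact: add0r. Qed.
Fact contSpace_addN : left_inverse contSpace_zero contSpace_opp contSpace_add.
Proof. by move=> f; apply: contSpaceP => w; exact: addNr. Qed.

HB.instance Definition _ := GRing.isZmodule.Build C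
  contSpace_addA contSpace_addC contSpace_add0 contSpace_addN.

Fact contSpace_scaleA (a b : R) (f : C) :
  contSpace_scale a (contSpace_scale b f) = contSpace_scale (a * b) f.
Proof. by apply: contSpaceP => w; exact: mulrA. Qed.
Fact contSpace_scale1 : left_id 1 contSpace_scale.
Proof. by move=> f; apply: contSpaceP => w; exact: mul1r. Qed.
Fact contSpace_scaleDr : right_distributive contSpace_scale +%R.
Proof. by move=> r f g; apply: contSpaceP => w; exact: mulrDr. Qed.
Fact contSpace_scaleDl (f : C) :
  {morph contSpace_scale^~ f : a b / a + b}.
Proof. by move=> a b; apply: contSpaceP => w; exact: mulrDl. Qed.

HB.instance Definition _ := GRing.Zmodule_isLmodule.Build R C
  contSpace_scaleA contSpace_scale1 contSpace_scaleDr contSpace_scaleDl.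

Definition sup_norm (f : C) : R := sup [set `|f w| | w in [set: Omega]].

Lemma sup_norm_ubound (f : C) : has_ubound [set `|f w| | w in [set: Omega]].
Proof.
have : compact (f @` [set: Omega]).
  apply: continuous_compact => //.
  exact/continuous_subspaceT/contSpace_continuous.
move=> /compact_bounded[M [_ /(_ (M + 1))]]; rewrite ltrDl => /(_ ltr01) fM.
by exists (M + 1) => _ [w _ <-]; apply: fM; exists w.
Qed.

Lemma le_sup_norm (f : C) w : `|f w| <= sup_norm f.
Proof. by apply: ub_le_sup; [exact: sup_norm_ubound|exists w]. Qed.

Lemma sup_norm_le (f : C) (M : R) :
  0 <= M -> (forall w, `|f w| <= M) -> sup_norm f <= M.
Proof.
move=> M0 fM; rewrite /sup_norm; set S := [set _ | _ in _].
have [->|/set0P S0] := eqVneq S set0; first by rewrite sup0.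
by apply: ge_sup => // _ [w _ <-].
Qed.

Lemma sup_norm_ge0 (f : C) : 0 <= sup_norm f.
Proof.
rewrite /sup_norm; set S := [set _ | _ in _].
have [->|/set0P[_ [w _ _]]] := eqVneq S set0; first by rewrite sup0.
exact: le_trans (le_sup_norm f w).
Qed.

Fact sup_normD (f g : C) : sup_norm (f + g) <= sup_norm f + sup_norm g.
Proof.
apply: sup_norm_le => [|w]; first by rewrite addr_ge0 ?sup_norm_ge0.
by apply: (le_trans (ler_normD (f w) (g w))); rewrite lerD ?le_sup_norm.
Qed.

Fact sup_normZ (r : R) (f : C) : sup_norm (r *: f) = `|r| * sup_norm f.
Proof.
apply/eqP; rewrite eq_le; apply/andP; split.
  apply: sup_norm_le => [|w]; first by rewrite mulr_ge0 ?sup_norm_ge0.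
  have -> : (r *: f : C) w = r * f w by [].
  by rewrite normrM ler_wpM2l ?le_sup_norm.
have [->|r0] := eqVneq r 0; first by rewrite normr0 mul0r sup_norm_ge0.
rewrite mulrC -ler_pdivlMr ?normr_gt0//.
apply: sup_norm_le => [|w]; first by rewrite divr_ge0 ?sup_norm_ge0.
rewrite ler_pdivlMr ?normr_gt0// mulrC -normrM.
exact: (le_sup_norm (r *: f) w).
Qed.

Fact sup_norm0_eq0 (f : C) : sup_norm f = 0 -> f = 0.
Proof.
move=> f0; apply: contSpaceP => w; apply/eqP; rewrite -normr_le0 -f0.
exact: le_sup_norm.
Qed.

HB.instance Definition _ :=
  Lmodule_isNormed.Build R C sup_normD sup_normZ sup_norm0_eq0.

End contSpace_normedModType.
Coercion contSpace_fun : contSpace >-> Funclass.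

Section weak_topology.
Context (R : realType) (X : normedModType R).

Definition dual : Type := {f : {linear X -> R^o} | continuous f}.

Definition dual_fun (f : dual) : X -> R := sval f.

Definition dual_norm (f : dual) : R :=
  sup [set `|dual_fun f x| | x in [set x : X | `|x| <= 1]].

Definition dual_ball : set dual := [set f | dual_norm f <= 1].

Definition weak_type : Type := sup_topology (fun f : dual =>
  Topological.class (initial_topology (dual_fun f : X -> R^o))).

HB.instance Definition _ := Topological.on weak_type.

Definition cwk : set (set X) := [set A |
  [/\ A !=set0, convex_set (A : set (convex_lmodType X)) &
      compact (A : set weak_type)]].

End weak_topology.

Section set_operations.
Context (R : realType) (X : normedModType R).
Implicit Types A C : set X.

Definition mink_add A C : set X := [set a + c | a in A & c in C].

Definition mink_scale (r : R) A : set X := [set r *: a | a in A].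

Definition closed_convex_hull A : set X :=
  closure (smallest (fun C : set (convex_lmodType X) => convex_set C) A).

(* Extended-real valued, hence meaningful on unbounded sets as well. *)
Definition hausdorff_dist A C : \bar R := maxe
  (ereal_sup [set ereal_inf [set `|a - c|%:E | c in C] | a in A])
  (ereal_sup [set ereal_inf [set `|a - c|%:E | a in A] | c in C]).

Definition support_fun (f : dual X) A : R := sup [set dual_fun f x | x in A].

End set_operations.

(* The map [i] is total on [set X] but constrained on [cwk] only. *)
Record cwk_embedding (R : realType) (X : normedModType R)
    (Omega : topologicalType) (cO : compact [set: Omega])
    (i : set X -> contSpace R Omega cO) : Prop := CwkEmbedding {
  embD : forall A C, cwk A -> cwk C -> i (mink_add A C) = i A + i C ;
  embZ : forall (r : R) A, 0 <= r -> cwk A -> i (mink_scale r A) = r *: i A ;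
  emb_isometry : forall A C, cwk A -> cwk C ->
    hausdorff_dist A C = `|i A - i C|%:E ;
  emb_closed : closed (i @` @cwk R X) ;
  emb_max : forall A C, cwk A -> cwk C ->
    forall w, i (closed_convex_hull (A `|` C)) w = Num.max (i A w) (i C w) }.

Section measures.
Context d (R : realType) (T : measurableMetricType d R).

Definition borel := @measurable d T = <<s (@open T)>>.

Definition regular_measure (mu : set T -> \bar R) := forall A, measurable A ->
  mu A = ereal_inf [set mu U | U in [set U | open U /\ A `<=` U]] /\
  mu A = ereal_sup [set mu K | K in [set K | compact K /\ K `<=` A]].

Definition pointwise_nonatomic (mu : set T -> \bar R) :=
  forall t : T, mu [set t] = 0%E.

End measures.

Record tagged_family (T : Type) := TaggedFamily {
  tf_size : nat ;
  tf_set : 'I_tf_size -> set T ;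
  tf_tag : 'I_tf_size -> T }.
Arguments tf_set {T} _ _.
Arguments tf_tag {T} _ _.

Section gauge_integral.
Context d (R : realType) (T : measurableMetricType d R).
Variable mu : set T -> \bar R.

Definition gauge (g : T -> R) := forall t, 0 < g t.

Definition is_partition (E : set T) (P : tagged_family T) :=
  [/\ forall j, measurable (tf_set P j),
      forall j l, j != l -> mu (tf_set P j `&` tf_set P l) = 0%E &
      \bigcup_j tf_set P j = E].

Definition gauge_fine (g : T -> R) (P : tagged_family T) :=
  forall j w, tf_set P j w -> mdist w (tf_tag P j) < g (tf_tag P j).

Definition riemann_sum (Y : normedModType R) (f : T -> Y)
    (P : tagged_family T) : Y :=
  \sum_(j < tf_size P) fine (mu (tf_set P j)) *: f (tf_tag P j).

Definition is_Hintegral (Y : normedModType R) (f : T -> Y) (I : Y) :=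
  forall e : R, 0 < e -> exists2 g, gauge g &
    forall P, is_partition setT P -> gauge_fine g P ->
      `|riemann_sum f P - I| <= e.

Definition Hintegrable (Y : normedModType R) (f : T -> Y) :=
  exists I, is_Hintegral f I.

Definition mink_sum (X : normedModType R) (F : T -> set X)
    (P : tagged_family T) : set X :=
  \big[@mink_add R X/[set 0]]_(j < tf_size P)
    mink_scale (fine (mu (tf_set P j))) (F (tf_tag P j)).

Definition is_mHintegral (X : normedModType R) (F : T -> set X) (J : set X) :=
  cwk J /\ forall e : R, 0 < e -> exists2 g, gauge g &
    forall P, is_partition setT P -> gauge_fine g P ->
      (hausdorff_dist (mink_sum F P) J <= e%:E)%E.

Definition mHintegrable (X : normedModType R) (F : T -> set X) :=
  exists J, is_mHintegral F J.

End gauge_integral.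

Section uniform_integrability.
Context d (T : measurableType d) (R : realType).
Local Open Scope ereal_scope.

Definition uniformly_integrable (mu : set T -> \bar R) (W : set (T -> R)) :=
  [/\ forall f, W f -> mu.-integrable setT (EFin \o f),
      exists M : R, forall f, W f -> \int[mu]_x `|f x|%:E <= M%:E &
      forall e : R, (0 < e)%R -> exists2 del : R, (0 < del)%R &
        forall f E, W f -> measurable E -> mu E <= del%:E ->
          \int[mu]_(x in E) `|f x|%:E <= e%:E].

End uniform_integrability.

(* Integrability is taken with respect to the completion of [mu]: an
   H-integrable real function need not be Borel measurable (e.g. the indicator
   of a non-Borel subset of a Borel null set). *)
Definition support_family_ui d (R : realType) (T : measurableMetricType d R)
    (mu : {measure set T -> \bar R}) (X : normedModType R) (F : T -> set X) :=
  uniformly_integrable (@completed_measure_extension _ T R mu)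
    [set (fun t => support_fun f (F t)) | f in @dual_ball R X].

(* Main.v *)
Require Import Defs.
From HB Require Import structures.
From mathcomp Require Import all_boot all_order all_algebra.
From mathcomp Require Import all_classical all_reals all_analysis.
From mathcomp Require Import measurable_realfun ring lra.

Set Implicit Arguments.
Unset Strict Implicit.
Unset Printing Implicit Defensive.

Import Order.TTheory GRing.Theory Num.Theory.
Import numFieldNormedType.Exports.

Local Open Scope classical_set_scope.
Local Open Scope ring_scope.

(* The embedding [i] turns Minkowski Riemann sums into Riemann sums of [i \o F],
   and the closedness of its range gives (1) <-> (2); a fixed fine partition of
   the complement of [E] gives (1) -> (3), completeness of [C(Omega)] the
   converse.

   For (4), a weakly compact convex set has a strongly exposed point [x], exposed
   by some functional [h]. Applied to the integral [J] of [F], any selection [f]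
   of [F] maximizing [h] pointwise is H-integrable with integral [x]: a Riemann
   sum of [f] is close to a point of [J] where [h] is almost maximal, hence close
   to [x]. Then [F - f] contains [0], so it is non-negative.

   For (5), tags are free, so for a gauge [g] the difference between the
   supremum and the infimum of [phi t] over the tags [t] with [d(w, t) < g t] is
   a Borel function of [w], and the Cauchy condition for Riemann sums bounds its
   integral. Hence [phi] lies between Borel functions with close integrals and is
   close in mean to a step function; the gauge is common to all support
   functions. *)

(** * Sublinear functionals and the Hahn-Banach theorem *)

Section hahn_banach.
Context (R : realType) (V : lmodType R).
Implicit Types (q : V -> R) (C : set V).

Definition sublinear q := (forall x y, q (x + y) <= q x + q y) /\
  (forall (t : R) x, 0 <= t -> q (t *: x) = t * q x).

(* A bare version of convexity, free of the interval types of [convex_set]. *)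
Definition is_convex C := forall x y (a b : R), C x -> C y ->
  0 <= a -> 0 <= b -> a + b = 1 -> C (a *: x + b *: y).

Lemma sublinear0 q : sublinear q -> q 0 = 0.
Proof. by move=> [_ /(_ 0 0 (lexx _))]; rewrite scale0r mul0r. Qed.

Lemma sublinearN q x : sublinear q -> - q (- x) <= q x.
Proof.
move=> sq; have := sq.1 x (- x); rewrite subrr sublinear0// => h.
by rewrite -subr_ge0 opprK.
Qed.

(** Under the hypotheses of the next section, this is the largest sublinear functional [p] with
    [p <= q] and [p (- c) <= - dlt] for all [c] in [C]. A linear functional below it is thus below
    [q] and at least [dlt] on [C]. *)
Definition squeeze q C (dlt : R) v :=
  inf [set z | exists t c, [/\ 0 <= t, C c & z = q (v + t *: c) - t * dlt]].

Section squeeze.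
Variables (q : V -> R) (C : set V) (dlt : R).
Hypotheses (sq : sublinear q) (cC : is_convex C) (C0 : C !=set0)
  (Cdlt : forall c, C c -> dlt <= q c).

Let has_lb v : has_lbound
  [set z | exists t c, [/\ 0 <= t, C c & z = q (v + t *: c) - t * dlt]].
Proof.
(* The infimum is finite because [q (v + t *: c) + q (- v) >= t * q c >= t * dlt]. *)
exists (- q (- v)) => _ [t [c [t0 Cc ->]]].
have := sq.1 (v + t *: c) (- v); rewrite addrAC subrr add0r sq.2//.
have := ler_wpM2l t0 (Cdlt Cc); lra.
Qed.

Let has_in v :
  [set z | exists t c, [/\ 0 <= t, C c & z = q (v + t *: c) - t * dlt]] !=set0.
Proof. by have [c Cc] := C0; exists (q (v + 0 *: c) - 0 * dlt), 0, c. Qed.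

Let squeeze_le v t c : 0 <= t -> C c -> squeeze q C dlt v <= q (v + t *: c) - t * dlt.
Proof. by move=> t0 Cc; apply: ge_inf => //; exists t, c. Qed.

Lemma squeeze_le_fun v : squeeze q C dlt v <= q v.
Proof.
by have [c /(squeeze_le v (lexx 0))] := C0; rewrite scale0r mul0r addr0 subr0.
Qed.

Lemma squeeze_shift v c : C c -> squeeze q C dlt v <= q (v + c) - dlt.
Proof. by move=> /(squeeze_le v ler01); rewrite scale1r mul1r. Qed.

Lemma squeeze_sublinear : sublinear (squeeze q C dlt).
Proof.
have pZ (t : R) x : 0 < t -> squeeze q C dlt (t *: x) <= t * squeeze q C dlt x.
  move=> t0; rewrite -ler_pdivrMl//; apply: lb_le_inf => // _ [s [c [s0 Cc ->]]].
  rewrite ler_pdivrMl// mulrBr -sq.2; last exact: ltW.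
  by rewrite scalerDr mulrA scalerA; apply: squeeze_le => //; rewrite mulr_ge0// ltW.
split=> [x y|t x].
  rewrite -lerBlDr; apply: lb_le_inf => // _ [s [c [s0 Cc ->]]].
  rewrite lerBlDl -lerBlDr; apply: lb_le_inf => // _ [t [c' [t0 Cc' ->]]].
  rewrite lerBlDr.
  have [st0|st0] := eqVneq (s + t) 0.
    have [-> ->] : s = 0 /\ t = 0 by lra.
    rewrite !scale0r !mul0r !addr0 !subr0 addrC.
    exact: le_trans (squeeze_le_fun _) (sq.1 _ _).
  have st : 0 < s + t by lra.
  (* Convexity of [C] merges the shifts [s *: c] and [t *: c'] into the single shift
     [(s + t) *: b]. *)
  pose b := (s / (s + t)) *: c + (t / (s + t)) *: c'.
  have Cb : C b.
    apply: cC => //; first exact: divr_ge0 (ltW st).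
      exact: divr_ge0 (ltW st).
    by rewrite -mulrDl divff.
  have := squeeze_le (x + y) (ltW st) Cb.
  have -> : x + y + (s + t) *: b = (y + t *: c') + (x + s *: c).
    rewrite /b scalerDr !scalerA !mulrA ![(s + t) * _]mulrC !mulfK//.
    by rewrite [RHS]addrC addrACA.
  have := sq.1 (y + t *: c') (x + s *: c); lra.
rewrite le_eqVlt => /predU1P[<-|t0].
  rewrite scale0r mul0r; apply/eqP; rewrite eq_le.
  rewrite -[X in _ <= X](sublinear0 sq) squeeze_le_fun/=.
  apply: lb_le_inf => // _ [s [c [s0 Cc ->]]].
  rewrite add0r sq.2// subr_ge0 ler_wpM2l//; exact: Cdlt.
apply/eqP; rewrite eq_le pZ//=.
have := pZ t^-1 (t *: x); rewrite invr_gt0 => /(_ t0).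
by rewrite scalerA mulVf ?gt_eqF// scale1r ler_pdivlMl.
Qed.

End squeeze.

(* Zorn yields a minimal sublinear functional below [q]; squeezing it along a
   point shows that it is additive. *)
Lemma sublinear_dominates_linear q : sublinear q ->
  exists g : {linear V -> R^o}, forall x, g x <= q x.
Proof.
move=> sq.
pose S := {p : V -> R | sublinear p /\ forall x, p x <= q x}.
pose rel (p r : S) : Prop := forall x, sval r x <= sval p x.
have [||||[p [sp pq]] /= pmin] := @Zorn S (fun p r => `[< rel p r >]).
- by move=> p; apply/asboolP => x.
- move=> r s t /asboolP rs /asboolP st; apply/asboolP => x.
  exact: le_trans (st x) (rs x).
- move=> [r hr] [s hs] /asboolP rs /asboolP sr; apply: eq_exist.
  by apply/funext => x; apply/eqP; rewrite eq_le (rs x) (sr x).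
- move=> A Atot; have [[a Aa]|A0] := pselect (A !=set0); last first.
    exists (exist _ q (conj sq (fun x => lexx (q x)))) => s As.
    by exfalso; apply: A0; exists s.
  (* The pointwise infimum of a chain is subadditive: of two members, the smaller one serves for
     both arguments. *)
  pose m x := inf [set sval p x | p in A].
  have Hn x : [set sval p x | p in A] !=set0 by exists (sval a x), a.
  have Hb x : has_lbound [set sval p x | p in A].
    exists (- q (- x)) => _ [p Ap <-].
    by apply: le_trans (sublinearN _ (svalP p).1); rewrite lerN2 (svalP p).2.
  have mle p x : A p -> m x <= sval p x.
    by move=> Ap; apply: ge_inf => //; exists p.
  have sm : sublinear m.
    split=> [x y|t x].
      rewrite -lerBlDr; apply: lb_le_inf => // _ [p Ap <-].
      rewrite lerBlDl -lerBlDr; apply: lb_le_inf => // _ [r Ar <-].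
      rewrite lerBlDr; case: (Atot _ _ Ap Ar) => /asboolP h.
        by have := mle _ (x + y) Ar; have := (svalP r).1.1 x y; have := h x; lra.
      by have := mle _ (x + y) Ap; have := (svalP p).1.1 x y; have := h y; lra.
    rewrite le_eqVlt => /predU1P[<-|t0].
      rewrite scale0r mul0r /m; have -> : [set sval p 0 | p in A] = [set 0].
        apply/seteqP; split=> [_ [p _ <-]|_ ->] /=.
          by rewrite sublinear0//; exact: (svalP p).1.
        by exists a => //; rewrite sublinear0//; exact: (svalP a).1.
      by rewrite inf1.
    apply/eqP; rewrite eq_le; apply/andP; split.
      rewrite -ler_pdivrMl//; apply: lb_le_inf => // _ [p Ap <-].
      rewrite ler_pdivrMl// -(svalP p).1.2; last exact: ltW.
      exact: mle.
    apply: lb_le_inf => // _ [p Ap <-].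
    rewrite (svalP p).1.2; last exact: ltW.
    by rewrite ler_pM2l//; exact: mle.
  have mq x : m x <= q x by apply: le_trans (mle _ _ Aa) ((svalP a).2 x).
  exists (exist _ m (conj sm mq)) => s As; apply/asboolP => x /=; exact: mle.
have pshift y x : p x + p y <= p (x + y).
  have cy : is_convex [set y].
    by move=> u v a b -> -> _ _ ab; rewrite /= -scalerDl ab scale1r.
  have y0 : [set y] !=set0 by exists y.
  have yp c : [set y] c -> p y <= p c by move=> ->.
  pose r := squeeze p [set y] (p y).
  have sr : sublinear r by exact: squeeze_sublinear.
  have rp z : r z <= p z by exact: squeeze_le_fun.
  have rq z : r z <= q z by exact: le_trans (rp z) (pq z).
  have /(congr1 sval) /= E : exist _ r (conj sr rq) = exist _ p (conj sp pq) :> S.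
    by apply: pmin; apply/asboolP.
  have : r x <= p (x + y) - p y by exact: squeeze_shift.
  rewrite E; lra.
have pD x y : p (x + y) = p x + p y by apply/eqP; rewrite eq_le sp.1 pshift.
have pN x : p (- x) = - p x.
  by apply/eqP; rewrite -addr_eq0 -pD addrC subrr sublinear0.
have pL : linear (p : V -> R^o).
  move=> t x y; rewrite pD; congr (_ + _).
  have [t0|t0] := leP 0 t; first by rewrite sp.2.
  rewrite -[t]opprK scaleNr pN sp.2; last by lra.
  by rewrite [RHS]scaleNr.
pose gL := GRing.isLinear.Build _ _ _ _ (p : V -> R^o) pL.
pose g : {linear V -> R^o} := HB.pack (p : V -> R^o) gL.
by exists g.
Qed.

Lemma hahn_banach_sup q C dlt : sublinear q -> is_convex C -> C !=set0 ->
  (forall c, C c -> dlt <= q c) ->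
  exists g : {linear V -> R^o},
    (forall x, g x <= q x) /\ (forall c, C c -> dlt <= g c).
Proof.
move=> sq cC C0 Cd.
have [g gle] := sublinear_dominates_linear (squeeze_sublinear sq cC C0 Cd).
exists g; split=> [x|c Cc]; first exact: le_trans (gle x) (squeeze_le_fun sq C0 Cd x).
have := le_trans (gle (- c)) (squeeze_shift sq Cd (- c) Cc).
by rewrite addNr sublinear0// linearN sub0r lerN2.
Qed.

End hahn_banach.

(** * Duality and the weak topology *)

Section duality.
Context (R : realType) (X : normedModType R).
Implicit Types (h : dual X) (A C : set X).

Lemma dual_funD h x y : dual_fun h (x + y) = dual_fun h x + dual_fun h y.
Proof. exact: linearD. Qed.

Lemma dual_funZ h (r : R) x : dual_fun h (r *: x) = r * dual_fun h x.
Proof. exact: linearZ. Qed.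

Lemma dual_funB h x y : dual_fun h (x - y) = dual_fun h x - dual_fun h y.
Proof. exact: linearB. Qed.

Lemma dual_fun0 h : dual_fun h 0 = 0.
Proof. exact: linear0. Qed.

Lemma dual_fun_sum h (I : Type) (r : seq I) (P : pred I) (f : I -> X) :
  dual_fun h (\sum_(i <- r | P i) f i) = \sum_(i <- r | P i) dual_fun h (f i).
Proof. exact: linear_sum. Qed.

Lemma linear_bounded_dual (g : {linear X -> R^o}) (M : R) :
  (forall x, `|g x| <= M * `|x|) -> exists h : dual X, forall x, dual_fun h x = g x.
Proof.
move=> gM; have cg : continuous g.
  apply/linear_bounded_continuous/linear_boundedP.
  near=> r => x; apply: le_trans (gM x) _; rewrite ler_wpM2r//.
by exists (exist _ g cg).
Unshelve. all: by end_near. Qed.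

Lemma dual_bounded h : exists2 M : R, 0 < M & forall x, `|dual_fun h x| <= M * `|x|.
Proof.
have /linear_bounded_continuous/linear_boundedP := svalP h.
move=> [M [_ Mh]]; exists (Num.max M 0 + 1).
  by rewrite ltr_wpDl// le_max lexx orbT.
by move=> x; apply: Mh; rewrite ltr_pwDr// le_max lexx.
Qed.

Lemma dual_ball_le h : dual_ball h -> forall x, `|dual_fun h x| <= `|x|.
Proof.
move=> hB x; have [M M0 hM] := dual_bounded h.
have [->|x0] := eqVneq x 0; first by rewrite dual_fun0 !normr0.
have nx : 0 < `|x| by rewrite normr_gt0.
rewrite -[leRHS]mul1r -ler_pdivrMr//.
apply: le_trans hB; apply: ub_le_sup.
  exists M => _ [y y1 <-]; apply: le_trans (hM y) _.
  by rewrite -[leRHS]mulr1 ler_wpM2l// ltW.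
exists (`|x|^-1 *: x); first by rewrite /= normrZ normfV normr_id mulVf ?gt_eqF.
by rewrite dual_funZ normrM normfV normr_id mulrC.
Qed.

Lemma dual_add_scale h (t : R) h' :
  exists k : dual X, forall x, dual_fun k x = dual_fun h x + t * dual_fun h' x.
Proof.
have [M M0 hM] := dual_bounded h; have [M' M'0 hM'] := dual_bounded h'.
pose k0 x : R^o := dual_fun h x + t * dual_fun h' x.
have kL : linear k0 by move=> a x y; rewrite /k0 !(dual_funD, dual_funZ) /GRing.scale/=; ring.
pose kM := GRing.isLinear.Build _ _ _ _ k0 kL.
pose k : {linear X -> R^o} := HB.pack k0 kM.
apply: (@linear_bounded_dual k (M + `|t| * M')) => x.
rewrite mulrDl (le_trans (ler_normD _ _))// lerD// normrM -mulrA ler_wpM2l//.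
Qed.

Lemma norm_sublinear : sublinear (fun x : X => `|x|).
Proof. by split=> [x y|t x t0]; [exact: ler_normD|rewrite normrZ ger0_norm]. Qed.

(** Hahn-Banach for the norm and the convex set [x - C]. A linear functional dominated by the norm
    satisfies [|g y| <= |y|], by evaluation at [- y], and is therefore continuous. *)
Lemma dual_separation C x (dlt : R) : is_convex C -> C !=set0 ->
  (forall c, C c -> dlt <= `|x - c|) ->
  exists2 h : dual X, (forall y, `|dual_fun h y| <= `|y|) &
    forall c, C c -> dlt <= dual_fun h x - dual_fun h c.
Proof.
move=> cC [c0 Cc0] Cd.
have [| |_ [c Cc <-]|g [gle gC]] :=
  @hahn_banach_sup _ _ _ [set x - c | c in C] dlt (@norm_sublinear).
- move=> _ _ a b [u Cu <-] [v Cv <-] a0 b0 ab; exists (a *: u + b *: v); first exact: cC.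
  by rewrite -[x in LHS](scale1r) -ab scalerDl !scalerBr opprD addrACA.
- by exists (x - c0), c0.
- exact: Cd.
have gN y : `|g y| <= `|y|.
  by rewrite ler_norml gle andbT lerNl -linearN (le_trans (gle _))// normrN.
have [|h hg] := @linear_bounded_dual g 1; first by move=> y; rewrite mul1r.
exists h => [y|c Cc]; first by rewrite hg.
by rewrite -dual_funB hg; apply: gC; exists c.
Qed.

Lemma dual_norming x :
  exists2 h : dual X, (forall y, `|dual_fun h y| <= `|y|) & `|x| <= dual_fun h x.
Proof.
have c0 : is_convex [set (0 : X)].
  by move=> u v a b -> -> _ _ _; rewrite /= !scaler0 addr0.
have [||h h1 hx] := dual_separation (x := x) (dlt := `|x|) c0.
- by exists 0.
- by move=> c ->; rewrite subr0.
- by exists h => //; have := hx 0 erefl; rewrite dual_fun0 subr0.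
Qed.

Lemma weak_continuous h : continuous (dual_fun h : weak_type X -> R^o).
Proof.
move=> x; have /cvg_sup/(_ h) hx : nbhs (x : weak_type X) --> (x : weak_type X) by [].
apply: (cvg_comp _ _ hx).
exact: (@initial_continuous _ _ (dual_fun h : X -> R^o) x).
Qed.

Lemma weak_cvgP (I : Type) (F : set_system I) (f : I -> X) (x : X) : Filter F ->
  (forall h, dual_fun h (f i) @[i --> F] --> (dual_fun h x : R^o)) ->
  (f @ F) --> (x : weak_type X).
Proof.
move=> FF hf; apply/cvg_sup => h A /= [_ [[B oB <-] Bx] BA].
have : nbhs (dual_fun h x : R^o) B by exact: open_nbhs_nbhs.
move=> /(hf h) hB; rewrite nbhs_simpl; change (F (f @^-1` A)).
by apply: (@filterS _ F FF _ _ _ hB) => i Bi; exact: BA.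
Qed.

Lemma weak_compact_argmax A h : A !=set0 -> compact (A : set (weak_type X)) ->
  exists2 a, A a & forall y, A y -> dual_fun h y <= dual_fun h a.
Proof.
move=> A0 cA; have [|a aA amax] := @compact_EVT_max (weak_type X) R (dual_fun h) A A0 cA.
  exact/continuous_subspaceT/weak_continuous.
by exists a => [|y Ay]; [exact/set_mem|apply/amax/mem_set].
Qed.

(* Weakly closed half-spaces are all the weak topology that is needed. *)
Lemma weak_compact_cluster A (u : nat -> X) : compact (A : set (weak_type X)) ->
  (forall n, A (u n)) -> exists2 x, A x &
    forall h (c : R) N, (forall n, (N <= n)%N -> c <= dual_fun h (u n)) ->
      c <= dual_fun h x.
Proof.
move=> cA uA.
have uF : (u @ \oo) A by exists 0%N => // n _; exact: uA.
have [x [Ax xc]] := cA (u @ \oo) _ uF.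
exists x => // h c N hN; rewrite leNgt; apply/negP => xlt.
have V : nbhs (x : weak_type X) [set y | dual_fun h y < c].
  have : nbhs (dual_fun h x : R^o) [set r : R^o | r < c].
    by apply: open_nbhs_nbhs; split => //; exact: open_lt.
  exact: (@weak_continuous h x).
have U : (u @ \oo) [set u n | n in [set n | (N <= n)%N]].
  by exists N => // n Nn /=; exists n.
have [_ [[n Nn <-] /=]] := xc _ _ U V.
by rewrite ltNge hN.
Qed.

End duality.

(** * Strongly exposed points of weakly compact sets *)

Section strongly_exposed.
Context (R : realType) (X : normedModType R).
Variables (K : set X) (B : R).
Hypotheses (cK : compact (K : set (weak_type X))) (K0 : K !=set0)
  (KB : forall z, K z -> `|z| <= B).
Implicit Types (g h : dual X).

Definition slice g (a : R) := [set z | K z /\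
  forall y, K y -> dual_fun g y - a <= dual_fun g z].

Let B0 : 0 <= B.
Proof. by have [z /KB] := K0; apply: le_trans. Qed.

Let KB2 y z : K y -> K z -> `|y - z| <= 2 * B.
Proof.
by move=> /KB yB /KB zB; rewrite (le_trans (ler_normB _ _))//; lra.
Qed.

(* Adding to [g] a small multiple of a functional norming [k - c], for a point [k]
   of a thin slice far from [c], tilts the slice away from the ball around [c]. *)
Lemma slice_cut g (a eta e : R) c : 0 < a -> 0 < eta -> 0 < e ->
  (forall b, 0 < b -> exists2 k, slice g b k & 2 * e < `|k - c|) ->
  exists g' a', [/\ 0 < a',
    forall x, `|dual_fun g' x - dual_fun g x| <= eta * `|x|,
    slice g' a' `<=` slice g a & forall z, slice g' a' z -> e < `|z - c|].
Proof.
move=> a0 eta0 e0 large.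
(* [tau <= eta] bounds the perturbation of [g], and [2 * B * tau <= a / 2] bounds its effect on
   differences of points of [K], as needed for nested slices. *)
pose tau := Num.min eta (a / (4 * (B + 1))).
have tau0 : 0 < tau.
  by rewrite lt_min eta0 divr_gt0// mulr_gt0//; have := B0; lra.
have tauB : 2 * B * tau <= a / 2.
  have : tau <= a / (4 * (B + 1)) by rewrite ge_min lexx orbT.
  rewrite ler_pdivlMr; last by have := B0; lra.
  have := B0; nra.
(* The depth [b] enters twice in each estimate: [2 * b <= a / 2] completes the nesting, and
   [2 * b <= tau * e] is the loss allowed between the distances [2 * e] and [e]. *)
pose b := Num.min (tau * e / 2) (a / 4).
have b0 : 0 < b by rewrite lt_min !divr_gt0// mulr_gt0.
have b1 : b <= tau * e / 2 by rewrite ge_min lexx.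
have b2 : b <= a / 4 by rewrite ge_min lexx orbT.
have [k [Kk gk] kc] := large b b0.
have [h h1 hk] := dual_norming (k - c).
have [g' g'E] := dual_add_scale g tau h.
exists g', b; split => //.
- move=> x; rewrite g'E addrAC subrr add0r normrM (gtr0_norm tau0).
  by apply: ler_pM => //; [exact: ltW|rewrite ge_min lexx].
- move=> z [Kz /(_ k Kk)]; rewrite !g'E => zk; split=> // y Ky.
  have := gk y Ky.
  have : dual_fun h z - dual_fun h k <= 2 * B.
    rewrite -dual_funB; apply: le_trans (ler_norm _) _.
    exact: le_trans (h1 _) (KB2 Kz Kk).
  move=> /(ler_wpM2l (ltW tau0)); lra.
- move=> z [Kz /(_ k Kk)]; rewrite !g'E => zk.
  have hz : dual_fun h (z - c) <= `|z - c| by exact: le_trans (ler_norm _) (h1 _).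
  apply: lt_le_trans hz; rewrite -(ltr_pM2l tau0) dual_funB.
  have : tau * (2 * e) < tau * dual_fun h (k - c).
    by rewrite ltr_pM2l//; exact: lt_le_trans kc hk.
  by have := gk z Kz; rewrite dual_funB; lra.
Qed.

(** One application of [slice_cut] for each centre in [s]. Here [r] is the part of the budget [eta]
    already spent; every cut spends half of what is left, so the total stays below [eta] and [large]
    continues to apply. *)
Lemma slice_cut_seq f g (r a eta e : R) (s : seq X) : 0 < a -> r < eta -> 0 < e ->
  (forall x, `|dual_fun g x - dual_fun f x| <= r * `|x|) ->
  (forall g' b c, (forall x, `|dual_fun g' x - dual_fun f x| <= eta * `|x|) ->
    0 < b -> exists2 k, slice g' b k & 2 * e < `|k - c|) ->
  exists g' r' a', [/\ 0 < a' /\ r' < eta,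
    forall x, `|dual_fun g' x - dual_fun f x| <= r' * `|x|,
    slice g' a' `<=` slice g a & forall z c, slice g' a' z -> c \in s -> e < `|z - c|].
Proof.
move=> + + e0 + large.
elim: s g r a => [|c s IH] g r a a0 reta gf.
  by exists g, r, a; split.
have [||g1 [a1 [a10 g1g s1 z1]]] := @slice_cut g a ((eta - r) / 2) e c a0 _ e0.
- by rewrite divr_gt0// subr_gt0.
- move=> b; apply: large => x; apply: le_trans (gf x) _.
  by rewrite ler_wpM2r// ltW.
have [||g2 [r2 [a2 [[a20 r2eta] g2f s2 z2]]]] := IH g1 ((eta + r) / 2) a1 a10.
- by lra.
- move=> x; rewrite -(subrKA (dual_fun g x)).
  apply: le_trans (ler_normD _ _) _.
  apply: le_trans (lerD (g1g x) (gf x)) _.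
  by rewrite -mulrDl ler_wpM2r//; lra.
exists g2, r2, a2; split=> // [z /s2/s1//|z c' zs].
by rewrite in_cons => /predU1P[->|/(z2 _ _ zs)//]; exact/z1/s2.
Qed.

(** For a non-empty convex [S], the convex hull of [S] and [x]. As a continuous image of [[0, 1] *
    S] it inherits compactness from [S]. *)
Definition hull_add (S : set X) (x : X) :=
  [set p.1 *: p.2 + (1 - p.1) *: x | p in `[0%R, 1%R]%classic `*` S].

Lemma hull_add_compact S x : compact S -> compact (hull_add S x).
Proof.
move=> cS; apply: (@continuous_compact (R * X)%type X); last first.
  by apply: compact_setX => //; exact: segment_compact.
apply: continuous_subspaceT => p.
apply: cvgD; first by apply: cvgZ; [exact: cvg_fst|exact: cvg_snd].
apply: cvgZ; last exact: cvg_cst.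
by apply: cvgB; [exact: cvg_cst|exact: cvg_fst].
Qed.

Lemma hull_add_convex S x : is_convex S -> is_convex (hull_add S x).
Proof.
move=> cS _ _ a b [[t u] /= [t01 Su] <-] [[t' u'] /= [t'01 Su'] <-] a0 b0 ab.
move: t01 t'01; rewrite !in_itv/= => /andP[t0 t1] /andP[t'0 t'1].
pose w := a * t + b * t'.
have w0 : 0 <= w by rewrite addr_ge0// mulr_ge0.
have w1 : w <= 1 by rewrite /w; nra.
have cx : a *: ((1 - t) *: x) + b *: ((1 - t') *: x) = (1 - w) *: x.
  by rewrite !scalerA -scalerDl; congr (_ *: _); rewrite /w; lra.
have [w00|wn0] := eqVneq w 0.
  exists (0, u) => /=; first by split => //; rewrite in_itv/= lexx ler01.
  have at0 : a * t = 0.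
    by move: w00; rewrite /w; have := mulr_ge0 a0 t0; have := mulr_ge0 b0 t'0; lra.
  have bt0 : b * t' = 0 by move: w00; rewrite /w at0 add0r.
  rewrite !scalerDr addrACA cx w00 !scalerA at0 bt0 !scale0r addr0//.
have wp : 0 < w by rewrite lt_neqAle eq_sym wn0.
exists (w, (a * t / w) *: u + (b * t' / w) *: u') => /=.
  split; first by rewrite in_itv/= w0 w1.
  apply: cS => //; rewrite ?divr_ge0 ?mulr_ge0//.
  by rewrite -mulrDl divff.
rewrite !scalerDr addrACA cx; congr (_ + _); rewrite !scalerA.
by rewrite ![w * _]mulrC !divfK.
Qed.

Lemma compact_net (S : set X) (e : R) : compact S -> 0 < e ->
  exists s : seq X, forall p, S p -> exists2 c, c \in s & `|p - c| < e.
Proof.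
move=> cS e0; move: cS; rewrite compact_cover => /(_ X S (fun c => ball c e)).
case=> [c _|p Sp|D _ DS]; first exact: ball_open.
  by exists p => //; exact: ballxx.
exists (finmap.enum_fset D) => p /DS [c cD]; rewrite -ball_normE /= => pc.
by exists c => //; rewrite distrC.
Qed.

(* Otherwise one builds nested slices, each avoiding a neighbourhood of the convex
   hull of the points picked in the previous ones. A weak cluster point of these
   points lies in all the slices, and by Mazur in the norm closure of the union
   of the hulls, a contradiction. *)
Lemma small_slice f (eta e : R) : 0 < eta -> 0 < e -> exists g a c,
  [/\ 0 < a, forall x, `|dual_fun g x - dual_fun f x| <= eta * `|x| &
      forall z, slice g a z -> `|z - c| <= 2 * e].
Proof.
move=> eta0 e0; apply: contrapT => nsmall.
have large g b c : (forall x, `|dual_fun g x - dual_fun f x| <= eta * `|x|) ->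
    0 < b -> exists2 k, slice g b k & 2 * e < `|k - c|.
  move=> gf b0; apply: contrapT => nk; apply: nsmall; exists g, b, c.
  by split=> // z zs; rewrite leNgt; apply/negP => ze; apply: nk; exists z.
(* A state of the construction: a functional [g], a bound [r < eta] on its distance to [f], the
   depth [a] of its slice, a compact convex set [D] holding the points picked so far, and the last
   of them, [x]. *)
pose good (s : dual X * R * R * (set X * X)) := let: (g, r, a, (D, x)) := s in
  [/\ [/\ 0 < a, r < eta & forall x, `|dual_fun g x - dual_fun f x| <= r * `|x|],
      slice g a x, D x, compact D & is_convex D].
pose sl (s : dual X * R * R * (set X * X)) := let: (g, r, a, _) := s in slice g a.
pose hl (s : dual X * R * R * (set X * X)) := let: (_, (D, _)) := s in D.
pose pt (s : dual X * R * R * (set X * X)) := s.2.2.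
pose next (s s' : {s | good s}) :=
  [/\ sl (sval s') `<=` sl (sval s), hl (sval s) `<=` hl (sval s') &
    forall z p, sl (sval s') z -> hl (sval s) p -> e / 2 < `|z - p|].
have nextP s : exists s', next s s'.
  case: s => [[[[g r] a] [S x]] /= [[a0 reta gf] xs Sx cS vS]].
  (* A slice that stays [e] away from the centres of an [e / 2]-net of the hull stays [e / 2] away
     from the whole hull. *)
  have [s sS] := compact_net cS (divr_gt0 e0 (ltr0n _ 2)).
  have [g' [r' [a' [[a'0 r'eta] g'f s' zs]]]] := slice_cut_seq s a0 reta e0 gf large.
  have [k Kk kmax] := weak_compact_argmax g' K0 cK.
  have ks : slice g' a' k.
    by split=> // y Ky; have := kmax y Ky; lra.
  have gd : good (g', r', a', (hull_add S k, k)).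
    split=> //; last 2 first.
    - exact: hull_add_compact.
    - exact: hull_add_convex.
    exists (0, x); first by split=> //=; rewrite in_itv/= lexx ler01.
    by rewrite /= scale0r add0r subr0 scale1r.
  exists (exist _ _ gd); split=> //= [p Sp|z p zs' /sS [c cs pc]].
    exists (1, p); first by split=> //=; rewrite in_itv/= lexx ler01.
    by rewrite /= subrr scale0r addr0 scale1r.
  have := zs z c zs' cs; have := ler_distD p z c; lra.
have [nx nxP] := choice nextP.
have [k Kk kmax] := weak_compact_argmax f K0 cK.
have gd0 : good (f, 0, 1, ([set k], k)).
  split=> //.
  - by split=> // x; rewrite subrr normr0 mul0r.
  - by split=> // y Ky; have := kmax y Ky; lra.
  - exact: compact_set1.
  - by move=> u v a b -> -> _ _ ab; rewrite /= -scalerDl ab scale1r.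
pose s n := iter n nx (exist _ _ gd0).
have sS n : next (s n) (s n.+1) by rewrite /s iterS.
have slm n m : (n <= m)%N -> sl (sval (s m)) `<=` sl (sval (s n)).
  move=> /subnK <-; elim: (m - n)%N => // j IH z; rewrite addSn.
  by case: (sS (j + n)%N) => + _ _ => /[apply] /IH.
have hlm n m : (n <= m)%N -> hl (sval (s n)) `<=` hl (sval (s m)).
  move=> /subnK <-; elim: (m - n)%N => // j IH z /IH; rewrite addSn.
  by case: (sS (j + n)%N) => _ + _ => /[apply].
pose u n := pt (sval (s n)).
have us n : sl (sval (s n)) (u n).
  by rewrite /u; case: (s n) => [[[[g r] a] [S x]]] /= [].
have uh n : hl (sval (s n)) (u n).
  by rewrite /u; case: (s n) => [[[[g r] a] [S x]]] /= [].
have slK n z : sl (sval (s n)) z -> K z.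
  by case: (s n) => [[[[g r] a] [S x]]] /= _ [].
have [x Kx xP] := weak_compact_cluster cK (fun n => slK n _ (us n)).
have xs n : sl (sval (s n)) x.
  have : forall m, (n <= m)%N -> sl (sval (s n)) (u m) by move=> m /slm; apply.
  case: (s n) => [[[[g r] a] [S y]]] /= _ H; split=> // w Kw.
  by apply: (xP g _ n) => m /H [_]; apply.
pose H := \bigcup_n hl (sval (s n)).
have cH : is_convex H.
  move=> v w a b [n _ hv] [m _ hw] a0 b0 ab; exists (maxn n m) => //.
  have := hlm _ _ (leq_maxl n m) _ hv; have := hlm _ _ (leq_maxr n m) _ hw.
  case: (s (maxn n m)) => [[[[g r] c] [S y]]] /= [_ _ _ _ cS] Sw Sv.
  exact: cS.
have uH n : H (u n) by exists n.
have [||h h1 hH] := @dual_separation _ _ H x (e / 2) cH.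
- by exists (u 0%N).
- by move=> c [n _ nc]; apply/ltW; case: (sS n) => _ _; apply.
(* [h'] is [- h]. The half-space [e / 2 - h x <= - h y] contains all the points [u n], hence their
   cluster point [x], which is absurd. *)
have [h' h'E] := dual_add_scale h (- 2) h.
have := xP h' (e / 2 - dual_fun h x) 0%N.
have /[swap] /[apply] : forall n, (0 <= n)%N -> e / 2 - dual_fun h x <= dual_fun h' (u n).
  by move=> n _; rewrite h'E; have := hH _ (uH n); lra.
by rewrite h'E; lra.
Qed.

(** A slice within [2 * (a / 4)] of a point has diameter at most [a]. The perturbation is
    proportional to [a], the depth of the previous slice, so that the perturbations can be summed
    along the iteration. *)
Lemma small_slice_refine g (a : R) : 0 < a -> exists g' a',
  [/\ 0 < a', a' <= a / 2,
    forall x, `|dual_fun g' x - dual_fun g x| <= a / (8 * (B + 1)) * `|x| &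
    forall y z, slice g' a' y -> slice g' a' z -> `|y - z| <= a].
Proof.
move=> a0; have B1 : 0 < 8 * (B + 1) by have := B0; lra.
have [g' [b [c [b0 g'g hc]]]] := small_slice g (divr_gt0 a0 B1) (divr_gt0 a0 (ltr0n R 4)).
have sub : slice g' (Num.min b (a / 2)) `<=` slice g' b.
  move=> z [Kz hz]; split=> // y Ky; apply: le_trans (hz y Ky).
  by rewrite lerD2l lerN2 ge_min lexx.
exists g', (Num.min b (a / 2)); split=> //.
- by rewrite lt_min b0 divr_gt0.
- by rewrite ge_min lexx orbT.
- move=> y z /sub/hc yc /sub/hc zc; rewrite (le_trans (ler_distD c _ _))//.
  by rewrite (distrC c); lra.
Qed.

(* The limit of functionals with ever smaller slices, each close enough to the
   previous one for the slices to stay nested. *)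
Lemma strongly_exposed_point : exists h x, [/\ K x,
  forall y, K y -> dual_fun h y <= dual_fun h x &
  forall e, 0 < e -> exists2 a, 0 < a &
    forall z, K z -> dual_fun h x - a <= dual_fun h z -> `|z - x| <= e].
Proof.
have [k Kk] := K0.
have [g0 _ _] := dual_norming k.
pose st := {p : dual X * R | 0 < p.2}.
pose next (p q : st) := [/\ (sval q).2 <= (sval p).2 / 2,
    forall x, `|dual_fun (sval q).1 x - dual_fun (sval p).1 x| <=
      (sval p).2 / (8 * (B + 1)) * `|x| &
    forall y z, slice (sval q).1 (sval q).2 y -> slice (sval q).1 (sval q).2 z ->
      `|y - z| <= (sval p).2].
have nextP p : exists q, next p q.
  case: p => [[g a] /= a0]; have [g' [a' [a'0 ? ? ?]]] := small_slice_refine g a0.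
  by exists (exist _ (g', a') a'0).
have [nx nxP] := choice nextP.
pose s n := iter n nx (exist _ (g0, 1) ltr01).
pose g n := (sval (s n)).1; pose a n := (sval (s n)).2.
have a0 n : 0 < a n by exact: svalP (s n).
have sS n : next (s n) (s n.+1) by rewrite /s iterS.
have aS n : a n.+1 <= a n / 2 by case: (sS n).
(* The perturbation bound [a n / (8 * (B + 1))] equals [a n / 2 * c]. Since the depths at least
   halve, it is at most [(a n - a n.+1) * c], and the bounds telescope. *)
pose c := (4 * (B + 1))^-1.
have c0 : 0 < c by rewrite invr_gt0; have := B0; lra.
have gS n x : `|dual_fun (g n.+1) x - dual_fun (g n) x| <= (a n - a n.+1) * c * `|x|.
  case: (sS n) => _ /(_ x) + _; move=> /le_trans; apply.
  apply: ler_wpM2r => //; rewrite -/(a n).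
  have -> : a n / (8 * (B + 1)) = a n / 2 * c.
    by rewrite /c; field; have := B0; lra.
  by rewrite ler_pM2r//; have := aS n; lra.
have gnm n m x : (n <= m)%N ->
    `|dual_fun (g m) x - dual_fun (g n) x| <= (a n - a m) * c * `|x|.
  move=> /subnK <-; elim: (m - n)%N => [|j IH]; first by rewrite !subrr normr0 !mul0r.
  rewrite addSn; have := gS (j + n)%N x.
  have := ler_distD (dual_fun (g (j + n)%N) x) (dual_fun (g (j + n).+1) x) (dual_fun (g n) x).
  lra.
have a_small e : 0 < e -> exists n, a n < e.
  move=> e0; have an n : a n <= n.+1%:R^-1.
    elim: n => [|n IH]; first by rewrite /a /= invr1.
    apply: le_trans (aS n) _; apply: (@le_trans _ _ (n.+1%:R^-1 / 2)).
      by rewrite ler_wpM2r.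
    rewrite -invfM lef_pV2 ?posrE ?mulr_gt0// -natrM ler_nat.
    by rewrite mulnC mulSn mul1n addSnnS leq_addl.
  have [n] := @ltr_add_invr R 0 e e0; rewrite add0r => ne.
  by exists n; exact: le_lt_trans (an n) ne.
pose V x := [set dual_fun (g n) x - a n * c * `|x| | n in [set: nat]].
have Vub x n : ubound (V x) (dual_fun (g n) x + a n * c * `|x|).
  move=> _ [m _ <-]; have ac j : 0 <= a j * c * `|x|.
    by rewrite !mulr_ge0// ltW.
  have an := ac n; have am := ac m.
  by case: (leqP n m) => [|/ltnW] /(gnm _ _ x); rewrite ler_norml => /andP[]; lra.
(* The pointwise limit of the [g n], taken as the supremum of their lower estimates; it lies within
   [a n * c * |x|] of every [g n], which yields linearity. *)
pose G x : R := sup (V x).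
have Gg n x : `|G x - dual_fun (g n) x| <= a n * c * `|x|.
  have : G x <= dual_fun (g n) x + a n * c * `|x|.
    by apply: ge_sup; [exists (dual_fun (g 0%N) x - a 0%N * c * `|x|), 0%N|exact: Vub].
  have : dual_fun (g n) x - a n * c * `|x| <= G x.
    by apply: ub_le_sup; [exists (dual_fun (g 0%N) x + a 0%N * c * `|x|); exact: Vub|exists n].
  by rewrite ler_norml; lra.
have GL : linear (G : X -> R^o).
  move=> t x y; apply/eqP; rewrite -subr_eq0 -normr_eq0 eq_le normr_ge0 andbT.
  apply/ler_addgt0Pr => e e0; rewrite add0r.
  pose M := c * (`|t *: x + y| + `|t| * `|x| + `|y|) + 1.
  have M0 : 0 < M by rewrite ltr_wpDl// mulr_ge0 ?addr_ge0 ?mulr_ge0// ltW.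
  have [n an] := a_small (e / M) (divr_gt0 e0 M0).
  have := Gg n (t *: x + y); have := Gg n y; have := ler_wpM2l (normr_ge0 t) (Gg n x).
  rewrite -normrM dual_funD dual_funZ; set gx := dual_fun _ x; set gy := dual_fun _ y.
  move=> h1 h2 h3.
  have -> : G (t *: x + y) - (t *: (G x : R^o) + G y) =
      (G (t *: x + y) - (t * gx + gy)) - t * (G x - gx) - (G y - gy).
    by rewrite /GRing.scale/=; ring.
  apply: le_trans (ler_normB _ _) _; apply: le_trans (lerD (ler_normB _ _) (lexx _)) _.
  have : a n * M <= e by rewrite -ler_pdivlMr// ltW.
  rewrite /M; have := a0 n; lra.
pose GM := GRing.isLinear.Build _ _ _ _ (G : X -> R^o) GL.
pose G' : {linear X -> R^o} := HB.pack (G : X -> R^o) GM.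
have [M M0 gM] := dual_bounded (g 0%N).
have [|h hG] := @linear_bounded_dual _ _ G' (M + a 0%N * c).
  move=> x; rewrite mulrDl; have := Gg 0%N x; have := gM x.
  have := ler_normD (G x - dual_fun (g 0%N) x) (dual_fun (g 0%N) x).
  by rewrite subrK /G'/=; lra.
have [x Kx xmax] := weak_compact_argmax h K0 cK.
exists h, x; split=> // e e0; have [n an] := a_small e e0.
(* On differences of points of [K], [h] and [g n.+1] differ by at most
   [a n.+1 * c * (2 * B) <= a n.+1 / 2]. So this slice of [h] lies in the slice of [g n.+1] of depth
   [a n.+1], whose diameter is at most [a n]. *)
exists (a n.+1 / 2); first exact: divr_gt0.
have sl z : K z -> dual_fun h x - a n.+1 / 2 <= dual_fun h z -> slice (g n.+1) (a n.+1) z.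
  move=> Kz zx; split=> // y Ky; have := xmax y Ky.
  have := Gg n.+1 (y - z); have := ler_wpM2l (ltW (a0 n.+1)) (KB2 Ky Kz).
  have cB : c * (2 * B) <= 1 / 2.
    by rewrite /c mulrC ler_pdivrMr; have := B0; lra.
  have := ler_wpM2l (ltW (a0 n.+1)) cB.
  have := ler_wpM2l (mulr_ge0 (ltW (a0 n.+1)) (ltW c0)) (KB2 Ky Kz).
  rewrite ler_norml => p1 p2 p3 /andP[p4 p5].
  move: zx; rewrite !hG /G'/= in p4 p5 * => zx yx.
  have : G (y - z) = G y - G z by exact: (linearB G').
  move: p4 p5; rewrite dual_funB; lra.
move=> z Kz zx; apply: le_trans (ltW an).
case: (sS n) => _ _; apply; apply: sl => //.
by have := a0 n.+1; lra.
Qed.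

End strongly_exposed.

(** * Convex weakly compact sets *)

Section cwk_theory.
Context (R : realType) (X : normedModType R).
Implicit Types A C : set X.

Lemma is_convexP A : convex_set (A : set (convex_lmodType X)) <-> is_convex A.
Proof.
split=> [cA x y a b Ax Ay a0 b0 ab|cA x y l /set_mem Ax /set_mem Ay].
  have a1 : a <= 1 by rewrite -ab lerDl.
  have := cA x y (Itv01 a0 a1) (mem_set Ax) (mem_set Ay).
  by move=> /set_mem; rewrite /conv/= /unstable.onem -ab addrAC subrr add0r.
apply/mem_set; apply: cA => //=; first by rewrite subr_ge0 le1.
by rewrite addrC subrK.
Qed.

Lemma cwk_set1 (x : X) : cwk [set x].
Proof.
split; [by exists x| |exact: compact_set1].
by apply/is_convexP => u v a b -> -> _ _ ab; rewrite /= -scalerDl ab scale1r.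
Qed.

Lemma cwk_add A C : cwk A -> cwk C -> cwk (mink_add A C).
Proof.
move=> [[a Aa] /is_convexP vA cA] [[c Cc] /is_convexP vC cC]; split.
- by exists (a + c), a => //; exists c.
- apply/is_convexP => _ _ s t [x Ax [y Cy <-]] [x' Ax' [y' Cy' <-]] s0 t0 st.
  exists (s *: x + t *: x'); first exact: vA.
  exists (s *: y + t *: y'); first exact: vC.
  by rewrite !scalerDr addrACA.
have -> : mink_add A C = (fun p : weak_type X * weak_type X =>
    (p.1 : X) + p.2 : weak_type X) @` (A `*` C).
  apply/seteqP; split=> [_ [x Ax [y Cy <-]]|_ [[x y] [Ax Cy] <-]].
    by exists (x, y).
  by exists x => //; exists y.
apply: (@continuous_compact (weak_type X * weak_type X)%type (weak_type X)); last first.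
  exact: (@compact_setX (weak_type X) (weak_type X)).
apply: continuous_subspaceT => p; apply: weak_cvgP => h.
under eq_fun do rewrite dual_funD.
rewrite dual_funD; apply: cvgD.
  apply: (@continuous_comp (weak_type X * weak_type X)%type (weak_type X) R^o fst
  (dual_fun h) p); [exact: cvg_fst|exact: weak_continuous].
apply: (@continuous_comp (weak_type X * weak_type X)%type (weak_type X) R^o snd
  (dual_fun h) p); [exact: cvg_snd|exact: weak_continuous].
Qed.

Lemma cwk_scale (r : R) A : cwk A -> cwk (mink_scale r A).
Proof.
move=> [[a Aa] /is_convexP vA cA]; split; first by exists (r *: a), a.
  apply/is_convexP => _ _ s t [x Ax <-] [x' Ax' <-] s0 t0 st.
  exists (s *: x + t *: x'); first exact: vA.
  by rewrite scalerDr !scalerA ![r * _]mulrC.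
apply: (@continuous_compact (weak_type X) (weak_type X)) cA.
apply: continuous_subspaceT => p.
apply: (@weak_cvgP _ _ _ (nbhs (p : weak_type X)) _ _ (nbhs_filter _)) => h.
under eq_fun do rewrite dual_funZ.
by rewrite dual_funZ; apply: cvgMl_tmp; exact: (@weak_continuous _ _ h p).
Qed.

(** Points of [A] converging to [x] in norm have a weak cluster point [y] in [A]; a functional
    norming [y - x] shows that [y = x]. *)
Lemma weak_compact_closed A : compact (A : set (weak_type X)) -> closed A.
Proof.
move=> cA x clx.
have uP n : exists u, A u /\ `|x - u| < n.+1%:R^-1.
  have : nbhs x (ball x (n.+1%:R^-1 : R)) by apply: nbhsx_ballx.
  by move=> /clx[u [Au]]; rewrite -ball_normE; exists u.
have [u uA] := choice uP.
have [y Ay yP] := weak_compact_cluster cA (fun n => (uA n).1).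
suff -> : x = y by [].
apply/eqP; rewrite -subr_eq0 -normr_eq0 eq_le normr_ge0 andbT.
apply/ler_addgt0Pr => e e0; rewrite add0r.
have [h h1 hxy] := dual_norming (y - x).
have [h' h'E] := dual_add_scale h (- 2) h.
rewrite distrC; apply: le_trans hxy _.
have [N] := @ltr_add_invr R 0 e e0; rewrite add0r => Ne.
have : - dual_fun h x - e <= dual_fun h' y.
  apply: (yP h' _ N) => n Nn; rewrite h'E.
  have un : `|x - u n| < e.
    apply: lt_le_trans (uA n).2 _; apply: le_trans (ltW Ne).
    by rewrite lef_pV2 ?posrE// ler_nat.
  have := le_trans (ler_norm _) (h1 (u n - x)).
  by rewrite dual_funB distrC; lra.
by rewrite h'E dual_funB; lra.
Qed.

(** The slack between [e] and [e'] is there because the infima defining the distance need not be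
    attained. *)
Lemma hausdorff_dist_lt A C (e e' : R) : (hausdorff_dist A C <= e%:E)%E -> e < e' ->
  (forall a, A a -> exists2 c, C c & `|a - c| < e') /\
  (forall c, C c -> exists2 a, A a & `|a - c| < e').
Proof.
rewrite /hausdorff_dist ge_max => /andP[h1 h2] ee'; split.
- move=> a Aa; have : (ereal_inf [set `|a - c|%:E | c in C] < e'%:E)%E.
    apply: le_lt_trans (_ : e%:E < e'%:E)%E; last by rewrite lte_fin.
    by apply: le_trans h1; apply: ereal_sup_ubound; exists a.
  by move=> /ereal_inf_lt[_ [c Cc <-]]; rewrite lte_fin; exists c.
- move=> c Cc; have : (ereal_inf [set `|a - c|%:E | a in A] < e'%:E)%E.
    apply: le_lt_trans (_ : e%:E < e'%:E)%E; last by rewrite lte_fin.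
    by apply: le_trans h2; apply: ereal_sup_ubound; exists c.
  by move=> /ereal_inf_lt[_ [a Aa <-]]; rewrite lte_fin; exists a.
Qed.

Lemma hausdorff_dist_set1 (x y : X) : hausdorff_dist [set x] [set y] = `|x - y|%:E.
Proof.
by rewrite /hausdorff_dist !(image_set1, ereal_inf1, ereal_sup1) maxxx.
Qed.

Lemma mink_add_set1 (x y : X) : mink_add [set x] [set y] = [set x + y].
Proof.
apply/seteqP; split=> [_ [_ -> [_ -> <-]]//|_ ->].
by exists x => //; exists y.
Qed.

End cwk_theory.

(** * Consequences of the properties of the embedding *)

Section embedding.
Context (R : realType) (X : normedModType R) (Omega : topologicalType).
Context (cO : compact [set: Omega]) (i : set X -> contSpace R Omega cO).
Hypothesis i_emb : cwk_embedding i.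
Implicit Types A C : set X.

Lemma emb_set0 : i [set 0] = 0.
Proof.
have := embD i_emb (cwk_set1 (0 : X)) (cwk_set1 0).
rewrite mink_add_set1 addr0 => /eqP.
by rewrite -subr_eq0 opprD addrA subrr sub0r oppr_eq0 => /eqP.
Qed.

Lemma emb_set1B (x y : X) : i [set x] - i [set y] = i [set x - y].
Proof.
have := embD i_emb (cwk_set1 (x - y)) (cwk_set1 y).
rewrite mink_add_set1 subrK => ->.
by rewrite addrK.
Qed.

Lemma norm_emb_set1 (x : X) : `|i [set x]| = `|x|.
Proof.
have := emb_isometry i_emb (cwk_set1 x) (cwk_set1 0).
by rewrite hausdorff_dist_set1 emb_set0 !subr0 => -[].
Qed.

(** The isometry gives norm boundedness of weakly compact convex sets directly: the Hausdorff
    distance from [A] to [{0}] is the real number [|i A|]. *)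
Lemma emb_bounded A : cwk A -> forall a, A a -> `|a| <= `|i A|.
Proof.
move=> cA a Aa; apply/ler_addgt0Pr => e e0.
have := emb_isometry i_emb cA (cwk_set1 0).
rewrite emb_set0 subr0 => hE.
have [||hA _] := @hausdorff_dist_lt _ _ A [set 0] `|i A| (`|i A| + e).
- by rewrite hE.
- by rewrite ltrDl.
by have [_ ->] := hA a Aa; rewrite subr0 => /ltW.
Qed.

(** [A] is closed, convex and contains [0], so it is its own closed convex hull with [{0}], and
    [i A] is the maximum of [i A] and [0]. *)
Lemma emb_ge0 A : cwk A -> A 0 -> forall w, 0 <= i A w.
Proof.
move=> cA A0 w; have := emb_max i_emb cA (cwk_set1 0) w.
have -> : A `|` [set 0] = A by apply/setUidl => _ ->.
have -> : closed_convex_hull A = A.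
  case: cA => _ vA /weak_compact_closed clA; rewrite /closed_convex_hull.
  by rewrite smallest_id// -(closure_id _).1.
by rewrite emb_set0 => ->; rewrite le_max lexx orbT.
Qed.

End embedding.

(** * Partitions and Riemann sums *)

Section partitions.
Context d (R : realType) (T : measurableMetricType d R).
Hypotheses (T_compact : compact [set: T]) (T_borel : borel T).
Variable mu : {finite_measure set T -> \bar R}.
Implicit Types (g : T -> R) (P : tagged_family T) (E : set T).

Lemma open_measurable_borel (U : set T) : open U -> measurable U.
Proof. by move=> oU; rewrite T_borel; exact: sub_sigma_algebra. Qed.

Lemma open_mdist_ball (t : T) (r : R) : open [set w | mdist w t < r].
Proof.
rewrite openE => w /= wt; apply/nbhs_ballP; exists (r - mdist w t) => /=.
  by rewrite subr_gt0.
move=> v; rewrite ballEmdist /= => wv.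
have := metric_triangle v w t; rewrite (metric_sym v w); lra.
Qed.

Lemma measurable_mdist_ball (t : T) (r : R) : measurable [set w | mdist w t < r].
Proof. exact/open_measurable_borel/open_mdist_ball. Qed.

Definition disjoint_family n (A : 'I_n -> set T) (t : 'I_n -> T) :=
  TaggedFamily (fun j => A j `\` \bigcup_(k in [set k : 'I_n | (k < j)%N]) A k) t.

Lemma disjoint_family_disjoint n (A : 'I_n -> set T) t j l : j != l ->
  tf_set (disjoint_family A t) j `&` tf_set (disjoint_family A t) l = set0.
Proof.
move=> jl; apply/seteqP; split=> // w [[/= Aj nj] [Al nl]].
move: jl; rewrite -val_eqE neq_ltn => /orP[jl|lj].
  by apply: nl; exists j.
by apply: nj; exists l.
Qed.

Lemma disjoint_family_partition n (A : 'I_n -> set T) t :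
  (forall j, measurable (A j)) ->
  is_partition mu (\bigcup_j A j) (disjoint_family A t).
Proof.
move=> mA; split=> [j|j l jl|].
- apply: measurableD => //; apply: fin_bigcup_measurable => // k _; exact: mA.
- by rewrite disjoint_family_disjoint.
apply/seteqP; split=> w [j _ /=]; first by move=> [Aj _]; exists j.
move=> Aj; have Pj : `[< A j w >] by apply/asboolP.
case: (@arg_minnP 'I_n j (fun k => `[< A k w >]) (fun k => k : nat) Pj) => k /asboolP Ak kmin.
exists k => //; split=> // -[l /= lk Al].
by have := kmin l (introT (asboolP _) Al); rewrite leqNgt lk.
Qed.

Lemma gauge_cover g : gauge g -> exists n (t : 'I_n -> T),
  forall w, exists j, mdist w (t j) < g (t j).
Proof.
move=> g0; move: T_compact; rewrite compact_cover.
move=> /(_ T setT (fun t => [set w | mdist w t < g t])); case=> [t _|w _|D _ Dw].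
- exact: open_mdist_ball.
- by exists w => //=; rewrite mdistxx.
exists (size (finmap.enum_fset D)), (tnth (in_tuple (finmap.enum_fset D))) => w.
have [//|t tD /= tw] := Dw w.
have /tnthP[j tj] : t \in in_tuple (finmap.enum_fset D) by [].
by exists j; rewrite -tj.
Qed.

(** Finitely many gauge balls cover the compact space; their traces on [E], made disjoint, keep
    their centres as tags, which is allowed even for centres outside [E]. *)
Lemma fine_partition_exists g E : gauge g -> measurable E ->
  exists2 P, is_partition mu E P & gauge_fine g P.
Proof.
move=> g0 mE; have [n [t tc]] := gauge_cover g0.
pose A j := E `&` [set w | mdist w (t j) < g (t j)].
have AE : \bigcup_j A j = E.
  by apply/seteqP; split=> [w [j _ []]//|w Ew]; have [j wj] := tc w; exists j.
exists (disjoint_family A t).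
  rewrite -[X in is_partition _ X]AE; apply: disjoint_family_partition => j.
  by apply: measurableI => //; exact: measurable_mdist_ball.
by move=> j w /= [[]].
Qed.

Definition tf_cat P Q : tagged_family T := TaggedFamily
  (fun j : 'I_(tf_size P + tf_size Q) => match fintype.split j with
    inl k => tf_set P k | inr k => tf_set Q k end)
  (fun j : 'I_(tf_size P + tf_size Q) => match fintype.split j with
    inl k => tf_tag P k | inr k => tf_tag Q k end).

Lemma tf_cat_fine g P Q : gauge_fine g P -> gauge_fine g Q -> gauge_fine g (tf_cat P Q).
Proof. by move=> fP fQ j w /=; case: fintype.split => k; [exact: fP|exact: fQ]. Qed.

Lemma tf_cat_partition P Q E : is_partition mu E P -> is_partition mu (~` E) Q ->
  is_partition mu setT (tf_cat P Q).
Proof.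
move=> [mP dP uP] [mQ dQ uQ].
have PQ k l : tf_set P k `&` tf_set Q l = set0.
  apply/seteqP; split=> // w [Pw Qw].
  have : (~` E) w by rewrite -uQ; exists l.
  by apply; rewrite -uP; exists k.
split=> [j|j l jl|] /=.
- by case: fintype.split.
- move: jl; rewrite -{1}(splitK j) -{1}(splitK l).
  case: (fintype.split j) => a; case: (fintype.split l) => b ab.
  + by apply: dP; apply: contraNneq ab => ->.
  + by rewrite PQ measure0.
  + by rewrite setIC PQ measure0.
  + by apply: dQ; apply: contraNneq ab => ->.
- have -> : [set: T] = \bigcup_j tf_set P j `|` \bigcup_j tf_set Q j.
    by rewrite uP uQ setUv.
  apply/seteqP; split=> w.
    move=> [j _ /=]; case: fintype.split => k; first by left; exists k.
    by right; exists k.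
  move=> [[k _ wk]|[k _ wk]].
    by exists (unsplit (inl k)) => //; rewrite unsplitK.
  by exists (unsplit (inr k)) => //; rewrite unsplitK.
Qed.

Lemma riemann_sum_cat (Y : normedModType R) (f : T -> Y) P Q :
  riemann_sum mu f (tf_cat P Q) = riemann_sum mu f P + riemann_sum mu f Q.
Proof.
rewrite /riemann_sum big_split_ord/=; congr (_ + _); apply: eq_bigr => k _.
  by rewrite (unsplitK (inl k)).
by rewrite (unsplitK (inr k)).
Qed.

Lemma riemann_sumD (Y : normedModType R) (f h : T -> Y) P :
  riemann_sum mu (fun t => f t + h t) P = riemann_sum mu f P + riemann_sum mu h P.
Proof. by rewrite -big_split/=; apply: eq_bigr => j _; rewrite scalerDr. Qed.

Lemma gauge_min g g' : gauge g -> gauge g' -> gauge (fun t => Num.min (g t) (g' t)).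
Proof. by move=> g0 g'0 t; rewrite lt_min g0 g'0. Qed.

Lemma gauge_fine_minl g g' P :
  gauge_fine (fun t => Num.min (g t) (g' t)) P -> gauge_fine g P.
Proof. by move=> f j w /f /lt_le_trans; apply; rewrite ge_min lexx. Qed.

Lemma gauge_fine_minr g g' P :
  gauge_fine (fun t => Num.min (g t) (g' t)) P -> gauge_fine g' P.
Proof. by move=> f j w /f /lt_le_trans; apply; rewrite ge_min lexx orbT. Qed.

Lemma Hintegral_unique (Y : normedModType R) (f : T -> Y) I I' :
  is_Hintegral mu f I -> is_Hintegral mu f I' -> I = I'.
Proof.
move=> fI fI'; apply/eqP; rewrite -subr_eq0 -normr_eq0 eq_le normr_ge0 andbT.
apply/ler_addgt0Pr => e e0; rewrite add0r.
have e2 : 0 < e / 2 by rewrite divr_gt0.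
have [g g0 gI] := fI _ e2; have [g' g'0 gI'] := fI' _ e2.
have [P pP fP] := fine_partition_exists (gauge_min g0 g'0) (@measurableT _ T).
have := gI P pP (gauge_fine_minl fP); have := gI' P pP (gauge_fine_minr fP).
have := ler_distD (riemann_sum mu f P) I I'; rewrite (distrC I (riemann_sum _ _ _)); lra.
Qed.

Lemma HintegralD (Y : normedModType R) (f h : T -> Y) I I' :
  is_Hintegral mu f I -> is_Hintegral mu h I' ->
  is_Hintegral mu (fun t => f t + h t) (I + I').
Proof.
move=> fI hI e e0; have e2 : 0 < e / 2 by rewrite divr_gt0.
have [g g0 gI] := fI _ e2; have [g' g'0 gI'] := hI _ e2.
exists (fun t => Num.min (g t) (g' t)); first exact: gauge_min.
move=> P pP fP; rewrite riemann_sumD opprD addrACA (le_trans (ler_normD _ _))//.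
have := gI P pP (gauge_fine_minl fP); have := gI' P pP (gauge_fine_minr fP); lra.
Qed.

Lemma HintegralN (Y : normedModType R) (f : T -> Y) I :
  is_Hintegral mu f I -> is_Hintegral mu (fun t => - f t) (- I).
Proof.
move=> fI e /fI[g g0 gP]; exists g => // P pP fP.
rewrite /riemann_sum; under eq_bigr do rewrite scalerN.
by rewrite sumrN -opprD normrN; exact: gP.
Qed.

End partitions.

(** * Completeness of C(Omega) and the Cauchy criterion *)

Section contSpace_complete.
Context (R : realType) (Omega : topologicalType) (cO : compact [set: Omega]).
Local Notation C := (contSpace R Omega cO).

Lemma contSpace_normB (f g : C) w : `|f w - g w| <= `|f - g|.
Proof. exact: (@le_sup_norm _ _ cO (f - g) w). Qed.

Lemma contSpace_complete (u : nat -> C) (e : nat -> R) : (forall n, 0 <= e n) ->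
  (forall r, 0 < r -> exists n, e n < r) ->
  (forall n m, `|u n - u m| <= e n + e m) ->
  exists l : C, forall n, `|u n - l| <= e n.
Proof.
move=> e_ge0 e_small cu; pose V w := [set u n w - e n | n in [set: nat]].
have Vub w n : ubound (V w) (u n w + e n).
  move=> _ [m _ <-]; have := le_trans (contSpace_normB (u m) (u n) w) (cu m n).
  by move=> /(le_trans (ler_norm _)); lra.
pose l w : R := sup (V w).
have ul w n : `|u n w - l w| <= e n.
  have : l w <= u n w + e n.
    by apply: ge_sup; [exists (u 0%N w - e 0%N), 0%N|exact: Vub].
  have : u n w - e n <= l w.
    by apply: ub_le_sup; [exists (u 0%N w + e 0%N); exact: Vub|exists n].
  by rewrite ler_norml; lra.
have cl : continuous l.
  move=> w; apply/cvgrPdist_le => r r0.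
  have [n ne] := e_small (r / 3) (divr_gt0 r0 (ltr0n R 3)).
  have cun : u n v @[v --> w] --> u n w by exact: contSpace_continuous.
  have /cvgrPdist_le/(_ _ (divr_gt0 r0 (ltr0n R 3))) := cun.
  apply: filterS => v /= uv; have := ul w n; have := ul v n.
  have := ler_distD (u n w) (l w) (l v); have := ler_distD (u n v) (u n w) (l v).
  rewrite (distrC (l w) (u n w)); lra.
exists (contSpace_mk cO cl) => n; apply: sup_norm_le => // w; exact: ul.
Qed.

(** The gauges [g n] are not assumed to decrease: the sums over [P n] and [P m] are compared through
    a partition fine for both gauges, and differ by at most [e n + e m]. *)
Lemma Hintegrable_cauchy d (T : measurableMetricType d R)
    (T_compact : compact [set: T]) (T_borel : borel T)
    (mu : {finite_measure set T -> \bar R}) (f : T -> C) :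
  (forall e : R, 0 < e -> exists2 g, gauge g & forall P1 P2,
    is_partition mu setT P1 -> gauge_fine g P1 ->
    is_partition mu setT P2 -> gauge_fine g P2 ->
    `|riemann_sum mu f P1 - riemann_sum mu f P2| <= e) -> Hintegrable mu f.
Proof.
move=> fC; pose e n : R := n.+1%:R^-1.
have e0 n : 0 < e n by rewrite invr_gt0.
have e_small r : 0 < r -> exists n, e n < r.
  by move=> /(@ltr_add_invr R 0)[n]; rewrite add0r; exists n.
have /choice[g gP] : forall n : nat, exists g, gauge g /\ forall P1 P2,
    is_partition mu setT P1 -> gauge_fine g P1 ->
    is_partition mu setT P2 -> gauge_fine g P2 ->
    `|riemann_sum mu f P1 - riemann_sum mu f P2| <= e n.
  by move=> n; have [g g0 gP] := fC _ (e0 n); exists g.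
have /choice[P PP] : forall n : nat, exists P,
    is_partition mu setT P /\ gauge_fine (g n) P.
  move=> n; have [P ? ?] := fine_partition_exists T_compact T_borel mu (gP n).1 measurableT.
  by exists P.
have [|I uI] := contSpace_complete (u := fun n => riemann_sum mu f (P n))
  (fun n => ltW (e0 n)) e_small.
  move=> n m; have [Q pQ fQ] := fine_partition_exists T_compact T_borel mu
    (gauge_min (gP n).1 (gP m).1) measurableT.
  have := (gP n).2 _ _ (PP n).1 (PP n).2 pQ (gauge_fine_minl fQ).
  have := (gP m).2 _ _ pQ (gauge_fine_minr fQ) (PP m).1 (PP m).2.
  have := ler_distD (riemann_sum mu f Q) (riemann_sum mu f (P n)) (riemann_sum mu f (P m)).
  by lra.
exists I => r r0; have [n ne] := e_small (r / 2) (divr_gt0 r0 (ltr0n R 2)).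
exists (g n); first exact: (gP n).1.
move=> Q pQ fQ; have := (gP n).2 _ _ pQ fQ (PP n).1 (PP n).2.
have := ler_distD (riemann_sum mu f (P n)) (riemann_sum mu f Q) I.
by have := uI n; lra.
Qed.

End contSpace_complete.

(** * Minkowski sums under the embedding *)

Section multifunctions.
Context d (R : realType) (T : measurableMetricType d R).
Hypotheses (T_compact : compact [set: T]) (T_borel : borel T).
Variables (mu : {finite_measure set T -> \bar R}) (X : normedModType R).
Context (Omega : topologicalType) (cO : compact [set: Omega]).
Variable i : set X -> contSpace R Omega cO.
Hypothesis i_emb : cwk_embedding i.
Implicit Types (F : T -> set X) (P : tagged_family T).

Lemma mink_sum_emb F P : (forall t, cwk (F t)) ->
  cwk (mink_sum mu F P) /\ i (mink_sum mu F P) = riemann_sum mu (fun t => i (F t)) P.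
Proof.
move=> cF; rewrite /mink_sum /riemann_sum.
apply: (big_rec2 (fun A s => cwk A /\ i A = s)).
  by split; [exact: cwk_set1|exact: emb_set0].
move=> j A s _ [cA <-]; have cj := cwk_scale (fine (mu (tf_set P j))) (cF (tf_tag P j)).
split; first exact: cwk_add.
by rewrite (embD i_emb)// (embZ i_emb)// fine_ge0.
Qed.

Lemma mink_sum_selection F P (f : T -> X) : (forall t, F t (f t)) ->
  mink_sum mu F P (riemann_sum mu f P).
Proof.
move=> fF; rewrite /mink_sum /riemann_sum; apply/set_mem.
apply: (big_rec2 (fun (A : set X) s => s \in A)) => [|j A s _ /set_mem As];
  apply/mem_set => //.
by exists (fine (mu (tf_set P j)) *: f (tf_tag P j)); [exists (f (tf_tag P j))|exists s].
Qed.

(** The weights are non-negative, so a linear functional can be maximized over a Minkowski sum term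
    by term. *)
Lemma mink_sum_le F P (h : dual X) (f : T -> X) :
  (forall t x, F t x -> dual_fun h x <= dual_fun h (f t)) ->
  forall a, mink_sum mu F P a -> dual_fun h a <= dual_fun h (riemann_sum mu f P).
Proof.
move=> hF; rewrite /mink_sum /riemann_sum.
apply: (big_rec2 (fun A s => forall a, A a -> dual_fun h a <= dual_fun h s)).
  by move=> _ ->.
move=> j A s _ IH _ [_ [x Fx <-] [a Aa <-]].
rewrite !dual_funD lerD ?IH// !dual_funZ ler_wpM2l ?fine_ge0//; exact: hF.
Qed.

Lemma mHintegral_emb F J : (forall t, cwk (F t)) ->
  is_mHintegral mu F J <-> cwk J /\ is_Hintegral mu (fun t => i (F t)) (i J).
Proof.
move=> cF; have dE P : cwk J -> hausdorff_dist (mink_sum mu F P) J =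
    `|riemann_sum mu (fun t => i (F t)) P - i J|%:E.
  by move=> cJ; have [cP <-] := mink_sum_emb P cF; exact: emb_isometry.
split=> -[cJ h]; split=> // e /h[g g0 gP]; exists g => // P pP fP;
  have := gP P pP fP; by rewrite dE// lee_fin.
Qed.

(** [I] is a limit of Riemann sums, which are the images under [i] of Minkowski sums, and the image
    of [cwk] is closed. *)
Lemma Hintegral_emb_image F I : (forall t, cwk (F t)) ->
  is_Hintegral mu (fun t => i (F t)) I -> exists2 J, cwk J & I = i J.
Proof.
move=> cF FI; have /(emb_closed i_emb) [J cJ <-] : closure (i @` @cwk R X) I.
  move=> B /nbhs_ballP[e /= e0 eB].
  have [g g0 gI] := FI _ (divr_gt0 e0 (ltr0n R 2)).
  have [P pP fP] := fine_partition_exists T_compact T_borel mu g0 measurableT.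
  have [cP iP] := mink_sum_emb P cF.
  exists (i (mink_sum mu F P)); split; first by exists (mink_sum mu F P).
  apply: eB; rewrite -ball_normE /= distrC iP.
  by apply: le_lt_trans (gI P pP fP) _; lra.
by exists J.
Qed.

Lemma mHintegrable_emb F : (forall t, cwk (F t)) ->
  mHintegrable mu F <-> Hintegrable mu (fun t => i (F t)).
Proof.
move=> cF; split=> [[J /(mHintegral_emb _ cF)[_ FJ]]|[I FI]]; first by exists (i J).
have [J cJ IJ] := Hintegral_emb_image cF FI.
by exists J; apply/(mHintegral_emb _ cF); rewrite -IJ.
Qed.

Lemma Hintegral_cauchy (Y : normedModType R) (f : T -> Y) I : is_Hintegral mu f I ->
  forall E, measurable E -> forall e : R, 0 < e -> exists2 g, gauge g & forall P1 P2,
    is_partition mu E P1 -> gauge_fine g P1 -> is_partition mu E P2 -> gauge_fine g P2 ->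
    `|riemann_sum mu f P1 - riemann_sum mu f P2| <= e.
Proof.
move=> fI E mE e e0; have [g g0 gI] := fI _ (divr_gt0 e0 (ltr0n R 2)).
exists g => // P1 P2 p1 f1 p2 f2.
have [Q pQ fQ] := fine_partition_exists T_compact T_borel mu g0 (measurableC mE).
have := gI _ (tf_cat_partition p1 pQ) (tf_cat_fine f1 fQ).
have := gI _ (tf_cat_partition p2 pQ) (tf_cat_fine f2 fQ).
rewrite !riemann_sum_cat; set s1 := riemann_sum _ _ P1; set s2 := riemann_sum _ _ P2.
set q := riemann_sum _ _ Q => h2 h1.
have := ler_distD I (s1 + q) (s2 + q); rewrite (distrC I (s2 + q)).
by rewrite opprD addrACA subrr addr0; lra.
Qed.

Lemma riemann_sum_emb_set1 (f : T -> X) P :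
  riemann_sum mu (fun t => i [set f t]) P = i [set riemann_sum mu f P].
Proof.
rewrite /riemann_sum; apply: (big_rec2 (fun s x => s = i [set x])).
  by rewrite emb_set0.
move=> j s x _ ->; rewrite -mink_add_set1 (embD i_emb); last 2 first.
- exact: cwk_set1.
- exact: cwk_set1.
congr (_ + _).
rewrite -(embZ i_emb) ?fine_ge0//; last exact: cwk_set1.
by rewrite /mink_scale image_set1.
Qed.

(** The map sending [x] to [i [set x]] is isometric and carries Riemann sums to Riemann sums. *)
Lemma Hintegral_emb_set1 (f : T -> X) x :
  is_Hintegral mu f x -> is_Hintegral mu (fun t => i [set f t]) (i [set x]).
Proof.
move=> fx e /fx[g g0 gP]; exists g => // P pP fP.
by rewrite riemann_sum_emb_set1 emb_set1B// norm_emb_set1//; exact: gP.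
Qed.

End multifunctions.

(** * Selections *)

Section selections.
Context d (R : realType) (T : measurableMetricType d R).
Hypotheses (T_compact : compact [set: T]) (T_borel : borel T).
Variables (mu : {finite_measure set T -> \bar R}) (X : normedModType R).
Context (Omega : topologicalType) (cO : compact [set: Omega]).
Variable i : set X -> contSpace R Omega cO.
Hypothesis i_emb : cwk_embedding i.
Variable F : T -> set X.
Hypothesis F_cwk : forall t, cwk (F t).
Implicit Types (h : dual X) (J : set X) (P : tagged_family T).

Lemma cwk_argmax h : exists f : T -> X,
  (forall t, F t (f t)) /\
  (forall t x, F t x -> dual_fun h x <= dual_fun h (f t)).
Proof.
have /choice[f fP] : forall t, exists x, F t x /\
    forall y, F t y -> dual_fun h y <= dual_fun h x.
  by move=> t; have [F0 _ /(weak_compact_argmax h F0)[x ? ?]] := F_cwk t; exists x.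
by exists f; split=> [t|t x]; [exact: (fP t).1|exact: (fP t).2].
Qed.

Lemma mHintegral_near J e : is_mHintegral mu F J -> 0 < e ->
  exists2 g, gauge g & forall P, is_partition mu setT P -> gauge_fine g P ->
    (forall a, mink_sum mu F P a -> exists2 y, J y & `|a - y| < e) /\
    (forall y, J y -> exists2 a, mink_sum mu F P a & `|a - y| < e).
Proof.
move=> [_ FJ] e0; have [g g0 gP] := FJ _ (divr_gt0 e0 (ltr0n R 2)).
exists g => // P pP fP; apply: hausdorff_dist_lt (gP P pP fP) _.
by rewrite ltr_pdivrMr// ltr_pMr// ltr1n.
Qed.

(* The selection maximizes a functional that strongly exposes a point of the
   integral, so that its Riemann sums are forced to converge to that point. *)
Lemma Hintegrable_selection J : is_mHintegral mu F J ->
  exists (f : T -> X) x, (forall t, F t (f t)) /\ is_Hintegral mu f x.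
Proof.
move=> FJ; have [J0 _ cJ] := FJ.1.
have [h [x [Jx xmax xexp]]] := strongly_exposed_point cJ J0 (emb_bounded i_emb FJ.1).
have [f [fF fmax]] := cwk_argmax h.
exists f, x; split=> // e e0.
have [a a0 ax] := xexp _ (divr_gt0 e0 (ltr0n R 2)).
have [M M0 hM] := dual_bounded h.
(* Passing from [x] to [b] and from the Riemann sum to [y] costs at most [M * r] each in the value
   of [h]; [2 * M * r <= a] then places [y] in the slice of depth [a] at [x]. The bound [e / 2]
   serves the final triangle inequality. *)
pose r := Num.min (e / 2) (a / (2 * M)).
have M20 : 0 < 2 * M by rewrite mulr_gt0.
have r0 : 0 < r by rewrite lt_min !divr_gt0.
have re : r <= e / 2 by rewrite ge_min lexx.
have rM : r * (2 * M) <= a by rewrite -ler_pdivlMr// ge_min lexx orbT.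
have hB u v : `|u - v| < r -> dual_fun h u - dual_fun h v <= M * r.
  move=> uv; rewrite -dual_funB (le_trans (ler_norm _))// (le_trans (hM _))//.
  by rewrite ler_pM2l// ltW.
have [g g0 gP] := mHintegral_near FJ r0.
exists g => // P pP fP; have [PJ JP] := gP P pP fP.
have [y Jy sy] := PJ _ (mink_sum_selection mu P fF).
have [b Pb bx] := JP _ Jx.
have := mink_sum_le fmax Pb; have := hB _ _ sy.
rewrite distrC in bx; have := hB _ _ bx => h1 h2 h3.
have := ax y Jy; have := ler_distD y (riemann_sum mu f P) x.
move=> h4 h5; have := h5 ltac:(lra); lra.
Qed.

(** Each sum is the maximum of [h] over a Minkowski sum, and both Minkowski sums are Hausdorff close
    to the same [J]; the gauge therefore serves the whole dual ball. One inequality suffices, as [P]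
    and [P'] can be exchanged. *)
Lemma support_fun_cauchy J e : is_mHintegral mu F J -> 0 < e ->
  exists2 g, gauge g & forall h, dual_ball h -> forall P P',
    is_partition mu setT P -> gauge_fine g P ->
    is_partition mu setT P' -> gauge_fine g P' ->
    \sum_(j < tf_size P) fine (mu (tf_set P j)) * support_fun h (F (tf_tag P j)) -
    \sum_(j < tf_size P') fine (mu (tf_set P' j)) * support_fun h (F (tf_tag P' j)) <= e.
Proof.
move=> FJ e0; have [g g0 gP] := mHintegral_near FJ (divr_gt0 e0 (ltr0n R 2)).
exists g => // h /dual_ball_le hB P P' pP fP pP' fP'.
have [f [fF fmax]] := cwk_argmax h.
have sE t : support_fun h (F t) = dual_fun h (f t).
  apply/eqP; rewrite eq_le; apply/andP; split.
    by apply: ge_sup => [|_ [x Fx <-]]; [exists (dual_fun h (f t)), (f t)|exact: fmax].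
  by apply: ub_le_sup; [exists (dual_fun h (f t)) => _ [x Fx <-]; exact: fmax|exists (f t)].
have sumE Q : \sum_(j < tf_size Q) fine (mu (tf_set Q j)) * support_fun h (F (tf_tag Q j)) =
    dual_fun h (riemann_sum mu f Q).
  by rewrite dual_fun_sum; apply: eq_bigr => j _; rewrite dual_funZ sE.
rewrite !sumE; have [PJ _] := gP P pP fP; have [_ JP'] := gP P' pP' fP'.
have [y Jy sy] := PJ _ (mink_sum_selection mu P fF).
have [b Pb yb] := JP' _ Jy.
have := mink_sum_le fmax Pb.
have := le_trans (ler_norm _) (hB (riemann_sum mu f P - y)).
rewrite distrC in yb; have := le_trans (ler_norm _) (hB (y - b)).
by rewrite !dual_funB; lra.
Qed.

Lemma support_fun_le h t : dual_ball h -> `|support_fun h (F t)| <= `|i (F t)|.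
Proof.
move=> /dual_ball_le hB; have [[x Fx] _ _] := F_cwk t.
have hF y : F t y -> `|dual_fun h y| <= `|i (F t)|.
  by move=> Fy; apply: le_trans (hB y) _; exact: emb_bounded.
rewrite ler_norml; apply/andP; split.
  apply: (@le_trans _ _ (dual_fun h x)).
    by have := hF x Fx; rewrite ler_norml => /andP[].
  apply: ub_le_sup; last by exists x.
  exists `|i (F t)| => _ [y Fy <-]; exact: le_trans (ler_norm _) (hF y Fy).
apply: ge_sup => [|_ [y Fy <-]]; first by exists (dual_fun h x), x.
exact: le_trans (ler_norm _) (hF y Fy).
Qed.

Lemma mHintegrable_decomposition : mHintegrable mu F ->
  exists (G : T -> set X) (f : T -> X),
    [/\ forall t, cwk (G t), forall t w, 0 <= i (G t) w,
        mHintegrable mu G, Hintegrable mu f &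
        forall t, F t = mink_add (G t) [set f t]].
Proof.
move=> [J FJ]; have [f [x [fF fx]]] := Hintegrable_selection FJ.
pose G t := mink_add (F t) [set - f t].
have cG t : cwk (G t) by apply: cwk_add => //; exact: cwk_set1.
exists G, f; split=> //.
- move=> t; apply: emb_ge0 => //.
  by exists (f t) => //; exists (- f t) => //; rewrite subrr.
- apply/(mHintegrable_emb T_compact T_borel mu i_emb cG).
  have -> : (fun t => i (G t)) = (fun t => i (F t) + i [set - f t]).
    by apply/funext => t; rewrite (embD i_emb)//; exact: cwk_set1.
  exists (i J + i [set - x]); apply: HintegralD.
    by apply (mHintegral_emb mu i_emb J F_cwk).
  by apply: Hintegral_emb_set1 => //; exact: HintegralN.
- by exists x.
- move=> t; apply/seteqP; split=> [y Fy|_ [_ [y Fy [_ -> <-]] [_ -> <-]]].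
    exists (y - f t); first by exists y => //; exists (- f t).
    by exists (f t) => //; rewrite subrK.
  by rewrite subrK.
Qed.

End selections.

(** * Uniform integrability *)

Section steps.
Context d (M : measurableType d) (R : realType).

Definition step n (E : 'I_n -> set M) (a : 'I_n -> R) x : R :=
  \sum_(j < n) a j * \1_(E j) x.

Lemma stepE n (E : 'I_n -> set M) a j x :
  (forall k l, k != l -> E k `&` E l = set0) -> E j x -> step E a x = a j.
Proof.
move=> dE Ej; rewrite /step (bigD1 j)//= big1 => [|k kj].
  by rewrite addr0 indicE mem_set// mulr1.
rewrite indicE memNset ?mulr0// => Ek.
by have : (E k `&` E j) x by []; rewrite dE.
Qed.

Lemma measurable_step n (E : 'I_n -> set M) a : (forall j, measurable (E j)) ->
  measurable_fun setT (step E a).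
Proof.
move=> mE; rewrite /step; apply: measurable_sum => j.
by apply: measurable_funM => //; exact: measurable_indic.
Qed.

Lemma integral_step (nu : {measure set M -> \bar R}) n (E : 'I_n -> set M) a :
  (forall j, measurable (E j)) -> (forall j, 0 <= a j) ->
  (\int[nu]_x (step E a x)%:E = \sum_(j < n) (a j)%:E * nu (E j))%E.
Proof.
move=> mE a0; rewrite /step.
under eq_integral do rewrite -sumEFin.
rewrite ge0_integral_sum//; last 2 first.
- move=> j; apply/measurable_EFinP; apply: measurable_funM => //; exact: measurable_indic.
- by move=> j x _; rewrite lee_fin mulr_ge0.
apply: eq_bigr => j _; under eq_integral do rewrite EFinM.
rewrite ge0_integralZl_EFin//; last first.
  by apply/measurable_EFinP; exact: measurable_indic.
by rewrite integral_indic// setIT.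
Qed.

(** The infimum [m] of the errors [D k] has integral zero, so it vanishes almost everywhere. Where
    it does, [phi] equals the measurable function [u], the infimum of the upper bounds [s k + D k];
    completeness of [nu] concludes. *)
Lemma measurable_of_approximations (nu : {measure set M -> \bar R})
    (phi : M -> R) (eps : nat -> R) :
  measure_is_complete nu -> (forall r, 0 < r -> exists k, eps k < r) ->
  (forall k, exists sD : (M -> R) * (M -> \bar R),
    [/\ measurable_fun setT sD.1, measurable_fun setT sD.2,
      forall x, (0 <= sD.2 x)%E, (\int[nu]_x sD.2 x <= (eps k)%:E)%E &
      forall x, (`|phi x - sD.1 x|%:E <= sD.2 x)%E]) ->
  measurable_fun setT (EFin \o phi).
Proof.
move=> nu_complete eps_small /choice[sD sDP].
pose s k := (sD k).1; pose D k := (sD k).2.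
pose u (x : M) := einfs (fun k => (s k x)%:E + D k x)%E 0%N.
pose m (x : M) := einfs (D ^~ x) 0%N.
have mle x k : (m x <= D k x)%E by apply: ereal_inf_lbound; exists k.
have ule x k : (u x <= (s k x)%:E + D k x)%E by apply: ereal_inf_lbound; exists k.
have m0 x : (0 <= m x)%E.
  by apply: le_ereal_inf_tmp => _ [k _ <-]; have [_ _ D0 _ _] := sDP k; exact: D0.
have mm : measurable_fun setT m.
  by apply: measurable_fun_einfs => k; case: (sDP k).
have mu_ : measurable_fun setT u.
  apply: measurable_fun_einfs => k; case: (sDP k) => ms mD _ _ _.
  by apply: emeasurable_funD => //; apply/measurable_EFinP.
have m_ae : ae_eq nu setT m (cst 0%E).
  apply/(ae_eq_integral_abs nu measurableT mm).
  under eq_integral do rewrite gee0_abs//.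
  apply/eqP; rewrite eq_le integral_ge0// andbT.
  apply/lee_addgt0Pr => r r0; rewrite add0e.
  have [k kr] := eps_small r r0; have [_ mD _ intD _] := sDP k.
  apply: (@le_trans _ _ (\int[nu]_x D k x)%E).
    by apply: ge0_le_integral => // x _; exact: mle.
  by apply: le_trans intD _; rewrite lee_fin ltW.
apply: (ae_measurable_fun nu_complete (f := u)) => //.
apply: filterS m_ae => x /(_ Logic.I) /= mx _.
apply/eqP; rewrite eq_le; apply/andP; split.
  apply/lee_addgt0Pr => r r0.
  have : (m x < (r / 2)%:E)%E by rewrite mx lte_fin divr_gt0.
  move=> /ereal_inf_lt[_ [k _ <-] Dr]; apply: le_trans (ule x k) _.
  have [_ _ D0 _ sD_] := sDP k.
  move: (D0 x) (sD_ x) Dr; rewrite -/(D k) -/(s k).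
  case: (D k x) => [v| |]//; rewrite !lee_fin lte_fin => v0.
  by rewrite ler_norml => /andP[]; lra.
apply: le_ereal_inf_tmp => _ [k _ <-]; have [_ _ _ _ /(_ x)] := sDP k.
rewrite -/(D k) -/(s k); case: (D k x) => [v| |]//.
  by rewrite !lee_fin ler_norml => /andP[]; lra.
by move=> _; rewrite addey// leey.
Qed.

Lemma integral_abs_le_const_add (nu : {measure set M -> \bar R}) (phi : M -> R)
    (D : M -> \bar R) (C : R) (E : set M) :
  0 <= C -> measurable E -> measurable_fun setT (EFin \o phi) ->
  measurable_fun setT D -> (forall x, 0 <= D x)%E ->
  (forall x, `|phi x|%:E <= C%:E + D x)%E ->
  (\int[nu]_(x in E) `|phi x|%:E <= C%:E * nu E + \int[nu]_x D x)%E.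
Proof.
move=> C0 mE mphi mD D0 phiD.
have mD' : measurable_fun E D by apply: measurable_funTS.
apply: (@le_trans _ _ (\int[nu]_(x in E) (C%:E + D x))%E).
  apply: ge0_le_integral => //.
  - apply: measurable_funTS; apply/measurable_EFinP.
    by apply: measurableT_comp => //; apply/measurable_EFinP.
  - by apply: emeasurable_funD => //; exact: measurable_cst.
rewrite ge0_integralD//.
by rewrite (integral_cst nu mE) leeD2l//; exact: ge0_subset_integral.
Qed.

End steps.

(** * Oscillation over gauge balls *)

Section oscillation.
Context d (R : realType) (T : measurableMetricType d R).
Hypotheses (T_compact : compact [set: T]) (T_borel : borel T).
Variable mu : {finite_measure set T -> \bar R}.

Let cT : measurableType _ := caratheodory_type (mu^*)%mu.
Let nu : {measure set cT -> \bar R} := @completed_measure_extension _ T R mu.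

Let mcT (A : set T) : measurable A -> measurable (A : set cT).
Proof. exact: caratheodory_measurable_mu_ext. Qed.

Let nuE (A : set T) : measurable A -> nu A = mu A.
Proof. exact: measurable_mu_extE. Qed.

(* Countably many tags suffice to see the graph of [phi] through gauge balls. *)
Lemma countable_tags (g phi : T -> R) : gauge g -> exists t : nat -> T,
  forall w r, 0 < r -> exists n, mdist w (t n) < g (t n) /\ `|phi w - phi (t n)| < r.
Proof.
move=> g0; have [Bs /countable_injP[f finj] [_ Bb]] := compact_second_countable T_compact.
(* A triple codes a basic open set, a precision and a rational. It selects, if possible, a point
   whose gauge ball contains the basic set and whose value is that close to the rational. *)
pose good (p : nat * nat * rat) (t : T) := exists V, [/\ Bs V, f V = p.1.1,
  forall w, V w -> mdist w t < g t & `|ratr p.2 - phi t| < p.1.2.+1%:R^-1].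
have [u uP] : {u : nat * nat * rat -> T & forall p t, good p t -> good p (u p)}.
  apply: (@choice _ _ (fun p v => forall t, good p t -> good p v)) => p.
  have [[t tp]|np] := pselect (exists t, good p t); first by exists t.
  by exists point => t tp; exfalso; apply: np; exists t.
exists (fun n => odflt point (omap u (unpickle n))) => w r r0.
have : nbhs w [set v | mdist v w < g w].
  by apply: open_nbhs_nbhs; split; [exact: open_mdist_ball|rewrite /= mdistxx].
move=> /Bb[V [BV Vw] Vg].
have [k] := @ltr_add_invr R 0 (r / 2) (divr_gt0 r0 (ltr0n R 2)); rewrite add0r => kr.
pose c : R := k.+1%:R^-1.
have wc : phi w < phi w + c by rewrite ltrDl invr_gt0.
have [q] := rat_in_itvoo wc; rewrite in_itv/= => /andP[q1 q2].
have /uP[V' [BV' fV' V'u]] : good (f V, k, q) w.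
  by exists V; split => //=; rewrite -/c ltr_norml; lra.
rewrite -/c => qu; exists (pickle (f V, k, q)); rewrite pickleK /=; split.
  by apply: V'u; rewrite (finj V' V) ?inE.
by move: qu kr; rewrite -/c !ltr_norml => /andP[]; lra.
Qed.

(** The points at which [p] attains the largest difference [phi m - phi n] among the pairs of sets
    containing the point. Ties let cells overlap. *)
Definition pair_cell (B : nat -> set T) (phi : nat -> R) (k : nat) (p : 'I_k * 'I_k) :=
  [set w | B p.1 w /\ B p.2 w] `&` \bigcap_(q in [set: 'I_k * 'I_k])
    (if phi q.1 - phi q.2 <= phi p.1 - phi p.2 then setT
     else ~` [set w | B q.1 w /\ B q.2 w]).

Lemma measurable_pair_cell B phi k (p : 'I_k * 'I_k) : (forall n, measurable (B n)) ->
  measurable (pair_cell B phi p).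
Proof.
move=> mB; apply: measurableI; first exact: measurableI.
apply: fin_bigcap_measurable => // q _; case: ifP => // _.
by apply: measurableC; exact: measurableI.
Qed.

Lemma pair_cell_cover B phi k n w : (n < k)%N -> B n w ->
  exists p : 'I_k * 'I_k, pair_cell B phi p w.
Proof.
move=> nk Bn; pose n0 := Ordinal nk.
pose P (p : 'I_k * 'I_k) := `[< B p.1 w /\ B p.2 w >].
have P0 : P (n0, n0) by apply/asboolP.
case: (@arg_maxP _ _ _ (n0, n0) P (fun p => phi p.1 - phi p.2) P0) => p /asboolP Bp pmax.
exists p; split=> // q _; case: ifPn => // qp /= Bq; move/negP: qp; apply.
by apply: pmax; apply/asboolP.
Qed.

Section bound.
Variables (g phi : T -> R) (e : R) (t : nat -> T) (n0 : nat).
Hypotheses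
  (cauchy : forall P P',
    is_partition mu setT P -> gauge_fine g P ->
    is_partition mu setT P' -> gauge_fine g P' ->
    \sum_(j < tf_size P) fine (mu (tf_set P j)) * phi (tf_tag P j) -
    \sum_(j < tf_size P') fine (mu (tf_set P' j)) * phi (tf_tag P' j) <= e)
  (t_cover : forall w, exists2 n, (n < n0)%N & mdist w (t n) < g (t n))
  (t_dense : forall w r, 0 < r -> exists n,
    mdist w (t n) < g (t n) /\ `|phi w - phi (t n)| < r).

Let B n := [set w | mdist w (t n) < g (t n)].

(* [D x] is the largest difference between values of [phi] at tags whose gauge
   balls contain [x]. Its integral is the difference of two Riemann sums with the
   same cells, and free tags make both partitions fine. *)
Lemma oscillation_step k : exists D : cT -> R, [/\ measurable_fun setT D,
  (\int[nu]_x (D x)%:E <= e%:E)%E,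
  forall x m n, (m < n0 + k)%N -> (n < n0 + k)%N -> B m x -> B n x ->
    phi (t m) - phi (t n) <= D x &
  forall x, exists m n, [/\ (m < n0 + k)%N, (n < n0 + k)%N, B m x, B n x &
    D x = phi (t m) - phi (t n)]].
Proof.
pose K := (n0 + k)%N; pose N := #|{: 'I_K * 'I_K}|.
pose pr (j : 'I_N) : 'I_K * 'I_K := enum_val j.
pose A (j : 'I_N) := pair_cell B (phi \o t) (pr j).
pose c (j : 'I_N) := phi (t (pr j).1) - phi (t (pr j).2).
have mA j : measurable (A j).
  by apply: measurable_pair_cell => n; exact: measurable_mdist_ball.
have AT : \bigcup_j A j = setT.
  apply/seteqP; split=> // w _; have [n nn0 nw] := t_cover w.
  have [p pw] := @pair_cell_cover B (phi \o t) K n w (leq_trans nn0 (leq_addr _ _)) nw.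
  by exists (enum_rank p) => //; rewrite /A /pr enum_rankK.
pose P1 := disjoint_family A (fun j => t (pr j).1).
pose P2 := disjoint_family A (fun j => t (pr j).2).
pose E (j : 'I_N) : set T := tf_set P1 j.
have pP1 : is_partition mu setT P1 by rewrite -AT; exact: disjoint_family_partition.
have pP2 : is_partition mu setT P2 by rewrite -AT; exact: disjoint_family_partition.
have fP1 : gauge_fine g P1 by move=> j w [[[]]].
have fP2 : gauge_fine g P2 by move=> j w [[[]]].
have mE j : measurable (E j) by case: pP1.
have dE j l : j != l -> E j `&` E l = set0 by exact: disjoint_family_disjoint.
have ET x : exists j, E j x.
  have : [set: T] x by []. case: pP1 => _ _ <- [j _ Ej]; by exists j.
have EA j x q : E j x -> B q.1 x -> B q.2 x ->
    (q.1 < K)%N -> (q.2 < K)%N -> phi (t q.1) - phi (t q.2) <= c j.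
  move=> [[_ /= Aj] _] B1 B2 q1 q2.
  by have := Aj (Ordinal q1, Ordinal q2) I; case: ifPn => //= _; case.
have c_ge0 j x : E j x -> 0 <= c j.
  move=> Ej; have := Ej => -[[[B1 _] _] _].
  by have := EA j x (nat_of_ord (pr j).1, nat_of_ord (pr j).1) Ej B1 B1
    (ltn_ord _) (ltn_ord _); rewrite subrr.
(* An empty cell may carry a negative [c j]. The absolute value makes all coefficients non-negative
   and changes nothing on the other cells. *)
exists (step (E : 'I_N -> set cT) (fun j => `|c j|)); split.
- by apply: measurable_step => j; exact/mcT.
- rewrite integral_step//; last by move=> j; exact/mcT.
  have -> : (\sum_(j < N) `|c j|%:E * nu (E j) =
      \sum_(j < N) (fine (mu (E j)) * c j)%:E)%E.
    apply: eq_bigr => j _; rewrite nuE//.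
    have [->|/set0P[x Ex]] := eqVneq (E j) set0; first by rewrite measure0 mule0 mul0r.
    rewrite EFinM fineK ?fin_num_measure// muleC.
    by rewrite ger0_norm//; exact: c_ge0 Ex.
  rewrite sumEFin lee_fin; apply: le_trans (cauchy pP1 fP1 pP2 fP2).
  by rewrite -sumrB; apply: ler_sum => j _; rewrite mulrBr.
- move=> x m n mK nK Bm Bn; have [j Ej] := ET x.
  rewrite (@stepE _ cT _ _ _ _ j x dE Ej); apply: le_trans (ler_norm _).
  exact: (EA j x (m, n)).
- move=> x; have [j Ej] := ET x; exists (pr j).1, (pr j).2.
  have := Ej => -[[[B1 B2] _] _]; split => //.
  by rewrite (@stepE _ cT _ _ _ _ j x dE Ej) ger0_norm//; exact: c_ge0 Ej.
Qed.

(** [D] is the increasing limit of the step functions for growing finite families of tags, so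
    monotone convergence preserves the bound [e]. By [t_dense], [phi x] is approximated by values at
    tags whose balls contain [x]. *)
Lemma oscillation_bound : exists D : cT -> \bar R, [/\ measurable_fun setT D,
  forall x, (0 <= D x)%E, (\int[nu]_x D x <= e%:E)%E &
  forall x n, mdist x (t n) < g (t n) -> (`|phi x - phi (t n)|%:E <= D x)%E].
Proof.
have [Dk DkP] := choice oscillation_step.
have Dk0 k x : 0 <= Dk k x.
  have [_ _ ub _] := DkP k; have [n nn0 Bn] := t_cover x.
  have nK := leq_trans nn0 (leq_addr k n0).
  by have := ub x n n nK nK Bn Bn; rewrite subrr.
have Dknd x : {homo (fun k => (Dk k x)%:E) : n m / (n <= m)%N >-> (n <= m)%E}.
  move=> a b ab; rewrite lee_fin; have [_ _ _ /(_ x)[m [n [ma na Bm Bn ->]]]] := DkP a.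
  have [_ _ ub _] := DkP b; apply: ub => //; [apply: leq_trans ma _|apply: leq_trans na _];
    by rewrite leq_add2l.
have Dkcvg x : cvgn (fun k => (Dk k x)%:E) by exact: ereal_nondecreasing_is_cvgn.
pose D (x : cT) := limn (fun k => (Dk k x)%:E).
have DkD k x : ((Dk k x)%:E <= D x)%E.
  apply: lime_ge => //; near=> j; apply: Dknd; near: j; exact: nbhs_infty_ge.
have mDk k : measurable_fun setT (fun x => (Dk k x)%:E).
  by apply/measurable_EFinP; case: (DkP k).
exists D; split.
- apply: (emeasurable_fun_cvg (fun k x => (Dk k x)%:E)) => // x _; exact: Dkcvg.
- by move=> x; apply: le_trans (DkD 0%N x); rewrite lee_fin.
- rewrite (monotone_convergence nu measurableT mDk); last 2 first.
  + by move=> k x _; rewrite lee_fin.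
  + by move=> x _; exact: Dknd.
  apply: lime_le.
    apply: ereal_nondecreasing_is_cvgn => a b ab; apply: ge0_le_integral => //.
    + by move=> x _; rewrite lee_fin.
    + by move=> x _; exact: Dknd.
  by near=> k; case: (DkP k).
- move=> x n Bn; apply/lee_addgt0Pr => r r0.
  have [m [Bm mr]] := t_dense x r0.
  have mK : (m < n0 + (maxn m n).+1)%N by rewrite ltn_addl// ltnS leq_maxl.
  have nK : (n < n0 + (maxn m n).+1)%N by rewrite ltn_addl// ltnS leq_maxr.
  have [_ _ ub _] := DkP (maxn m n).+1.
  have h1 := ub x m n mK nK Bm Bn; have h2 := ub x n m nK mK Bn Bm.
  apply: le_trans (leeD (DkD (maxn m n).+1 x) (lexx r%:E)).
  rewrite -EFinD lee_fin; have := ler_distD (phi (t m)) (phi x) (phi (t n)).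
  have : `|phi (t m) - phi (t n)| <= Dk (maxn m n).+1 x by rewrite ler_norml; lra.
  lra.
Unshelve. all: by end_near. Qed.

End bound.

(* [phi] oscillates by at most [D] around the tags of a finite cover chosen
   beforehand from the gauge alone. *)
Lemma oscillation_cover (g phi : T -> R) (e : R) n0 (c : 'I_n0 -> T) : gauge g ->
  (forall P P', is_partition mu setT P -> gauge_fine g P ->
    is_partition mu setT P' -> gauge_fine g P' ->
    \sum_(j < tf_size P) fine (mu (tf_set P j)) * phi (tf_tag P j) -
    \sum_(j < tf_size P') fine (mu (tf_set P' j)) * phi (tf_tag P' j) <= e) ->
  (forall w, exists j, mdist w (c j) < g (c j)) ->
  exists D : cT -> \bar R, [/\ measurable_fun setT D,
    forall x, (0 <= D x)%E, (\int[nu]_x D x <= e%:E)%E &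
    forall x j, mdist x (c j) < g (c j) -> (`|phi x - phi (c j)|%:E <= D x)%E].
Proof.
move=> g0 cauchy c_cover; have [t tP] := countable_tags phi g0.
(* The tags of the cover come first, so that the first [n0] tags already cover the space; the
   countable family follows, shifted by [n0]. *)
pose tau n := if insub n is Some j then c j else t (n - n0)%N.
have tau_c (j : 'I_n0) : tau j = c j by rewrite /tau valK.
have tau_t n : tau (n0 + n)%N = t n.
  by rewrite /tau insubF ?addKn//; apply/negbTE; rewrite -leqNgt leq_addr.
have [||D [mD D0 intD DP]] := oscillation_bound (t := tau) (n0 := n0) cauchy.
- by move=> w; have [j wj] := c_cover w; exists j => //; rewrite tau_c.
- by move=> w r /(tP w)[n nP]; exists (n0 + n)%N; rewrite tau_t.
by exists D; split=> // x j xj; rewrite -tau_c; apply: DP; rewrite tau_c.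
Qed.

(** The step function taking the value of [phi] at a cover tag on the corresponding cell is within
    [D] of [phi], and the integral of [D] is as small as desired. *)
Lemma cauchy_sums_completed_measurable (phi : T -> R) :
  (forall e, 0 < e -> exists2 g, gauge g & forall P P',
    is_partition mu setT P -> gauge_fine g P ->
    is_partition mu setT P' -> gauge_fine g P' ->
    \sum_(j < tf_size P) fine (mu (tf_set P j)) * phi (tf_tag P j) -
    \sum_(j < tf_size P') fine (mu (tf_set P' j)) * phi (tf_tag P' j) <= e) ->
  measurable_fun setT (EFin \o (phi : cT -> R)).
Proof.
move=> cauchy.
pose eps k : R := k.+1%:R^-1.
have eps0 k : 0 < eps k by rewrite invr_gt0.
have eps_small r : 0 < r -> exists k, eps k < r.
  by move=> /(@ltr_add_invr R 0)[k]; rewrite add0r; exists k.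
have : forall k, exists sD : (cT -> R) * (cT -> \bar R),
    [/\ measurable_fun setT sD.1, measurable_fun setT sD.2,
      forall x, (0 <= sD.2 x)%E, (\int[nu]_x sD.2 x <= (eps k)%:E)%E &
      forall x, (`|phi x - sD.1 x|%:E <= sD.2 x)%E].
  move=> k; have [g g0 gP] := cauchy _ (eps0 k).
  have [n [c c_cover]] := gauge_cover T_compact g0.
  have [D [mD D0 intD DP]] := oscillation_cover g0 gP c_cover.
  pose A j := [set w | mdist w (c j) < g (c j)].
  have AT : \bigcup_j A j = setT.
    by apply/seteqP; split=> // w _; have [j wj] := c_cover w; exists j.
  have [mP _ uP] := @disjoint_family_partition _ _ _ mu _ A c
    (fun j => measurable_mdist_ball T_borel (c j) (g (c j))).
  exists (step (tf_set (disjoint_family A c) : 'I_n -> set cT) (phi \o c), D).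
  split=> //=.
    by apply: measurable_step => j; exact/mcT/mP.
  move=> x; have : [set: T] x by [].
  rewrite -AT -uP => -[j _ Ej].
  rewrite (@stepE _ cT _ _ _ _ j x _ Ej); last by move=> a b; exact: disjoint_family_disjoint.
  by apply: DP; case: Ej.
move=> approx; apply: (measurable_of_approximations (nu := nu)) approx.
  exact: measure_is_complete_caratheodory.
exact: eps_small.
Qed.

(** Every point lies in the ball of some cover tag, whence [|phi| <= C + D] with [D] of integral at
    most [e]. *)
Lemma integral_abs_le (g phi : T -> R) (e C : R) n0 (c : 'I_n0 -> T) : gauge g ->
  (forall P P', is_partition mu setT P -> gauge_fine g P ->
    is_partition mu setT P' -> gauge_fine g P' ->
    \sum_(j < tf_size P) fine (mu (tf_set P j)) * phi (tf_tag P j) -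
    \sum_(j < tf_size P') fine (mu (tf_set P' j)) * phi (tf_tag P' j) <= e) ->
  (forall w, exists j, mdist w (c j) < g (c j)) -> (forall j, `|phi (c j)| <= C) ->
  measurable_fun setT (EFin \o (phi : cT -> R)) ->
  forall E : set cT, measurable E ->
    (\int[nu]_(x in E) `|phi x|%:E <= C%:E * nu E + e%:E)%E.
Proof.
move=> g0 cauchy c_cover cC mphi E mE.
have [D [mD D0 intD DP]] := oscillation_cover g0 cauchy c_cover.
have C0 : 0 <= C by have [j _] := c_cover point; exact: le_trans (cC j).
apply: le_trans (leeD2l _ intD).
apply: integral_abs_le_const_add => // x; have [j xj] := c_cover x.
have := DP x j xj; case: (D x) => [v| |]//.
  rewrite -EFinD !lee_fin => h.
  have := ler_normD (phi x - phi (c j)) (phi (c j)); rewrite subrK.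
  by have := cC j; lra.
by move=> _; rewrite addey// leey.
Qed.

Lemma completed_measure_setT_lty : (nu setT < +oo)%E.
Proof. by rewrite nuE// ltey_eq fin_num_measure. Qed.

End oscillation.

(** * Uniform integrability of the support functions *)

Section uniform_integrability_of_supports.
Context d (R : realType) (T : measurableMetricType d R).
Hypotheses (T_compact : compact [set: T]) (T_borel : borel T).
Variables (mu : {finite_measure set T -> \bar R}) (X : normedModType R).
Context (Omega : topologicalType) (cO : compact [set: Omega]).
Variable i : set X -> contSpace R Omega cO.
Hypothesis i_emb : cwk_embedding i.

Lemma mHintegrable_support_family_ui (F : T -> set X) : (forall t, cwk (F t)) ->
  mHintegrable mu F -> support_family_ui mu F.
Proof.
move=> cF [J FJ].
pose nu : {measure set _ -> \bar R} := @completed_measure_extension _ T R mu.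
pose W := [set (fun t => support_fun f (F t)) | f in @dual_ball R X].
have mW f : W f -> measurable_fun setT (EFin \o (f : caratheodory_type (mu^*)%mu -> R)).
  move=> [h hB <-]; apply: cauchy_sums_completed_measurable => // e e0.
  have [g g0 gP] := support_fun_cauchy cF FJ e0.
  by exists g => // P P'; exact: gP.
have bound e : 0 < e -> exists2 C : R, 0 <= C & forall f E, W f -> measurable E ->
    (\int[nu]_(x in E) `|f x|%:E <= C%:E * nu E + e%:E)%E.
  move=> e0; have [g g0 gP] := support_fun_cauchy cF FJ e0.
  have [n [c c_cover]] := gauge_cover T_compact g0.
  (* The sum dominates each term, hence the values at all cover tags of all support functions from
     the dual ball. *)
  exists (\sum_(j < n) `|i (F (c j))|); first exact: sumr_ge0.
  move=> f E Wf mE; have mf := mW f Wf; case: Wf mf => h hB <- mf.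
  apply: (integral_abs_le T_compact T_borel g0 (gP h hB) c_cover) => // j.
  apply: le_trans (support_fun_le i_emb cF _ hB) _.
  by rewrite (bigD1 j)//= lerDl sumr_ge0.
have nuT := completed_measure_setT_lty mu.
have nuT_fin : nu setT \is a fin_num by rewrite ge0_fin_numE.
split.
- move=> f Wf; apply/integrableP; split; first exact: mW.
  have [C C0 CP] := bound 1 ltr01.
  apply: le_lt_trans (CP f setT Wf measurableT) _.
  by rewrite -(fineK nuT_fin) -EFinM -EFinD ltry.
- have [C C0 CP] := bound 1 ltr01.
  exists (C * fine (nu setT) + 1) => f Wf.
  by rewrite EFinD EFinM fineK//; exact: CP.
- move=> e e0; have e2 : 0 < e / 2 by rewrite divr_gt0.
  have [C C0 CP] := bound _ e2; have C1 : 0 < C + 1 by rewrite ltr_wpDl.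
  (* [C + 1] keeps the divisor positive when [C] is zero; the choice gives [C * nu E <= e / 2]. *)
  exists (e / 2 / (C + 1)); first exact: divr_gt0.
  move=> f E Wf mE nuE; apply: le_trans (CP f E Wf mE) _.
  have nuE_fin : nu E \is a fin_num.
    by rewrite ge0_fin_numE//; apply: le_lt_trans nuE _; rewrite ltry.
  have : fine (nu E) <= e / 2 / (C + 1) by rewrite -lee_fin fineK.
  rewrite ler_pdivlMr// => nuEe.
  rewrite -[nu E]fineK// -EFinM -EFinD lee_fin.
  by have : 0 <= fine (nu E) by [rewrite fine_ge0]; lra.
Qed.

End uniform_integrability_of_supports.

Theorem theorem3p4 (R : realType) (d : measure_display)
    (T : measurableMetricType d R)
    (T_compact : compact [set: T]) (T_borel : borel T)
    (mu : {finite_measure set T -> \bar R})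
    (mu_regular : regular_measure mu) (mu_nonatomic : pointwise_nonatomic mu)
    (X : completeNormedModType R)
    (Omega : topologicalType) (cO : compact [set: Omega])
    (hO : hausdorff_space Omega)
    (i : set X -> contSpace R Omega cO) (i_emb : cwk_embedding i)
    (F : T -> set X) (F_cwk : forall t, cwk (F t)) :
  [/\ mHintegrable mu F <-> Hintegrable mu (fun t => i (F t)),
      forall J I, is_mHintegral mu F J ->
        is_Hintegral mu (fun t => i (F t)) I -> I = i J,
      mHintegrable mu F <->
        (forall E, measurable E -> forall e : R, 0 < e ->
          exists2 g, gauge g & forall P1 P2,
            is_partition mu E P1 -> gauge_fine g P1 ->
            is_partition mu E P2 -> gauge_fine g P2 ->
            `|riemann_sum mu (fun t => i (F t)) P1 -
              riemann_sum mu (fun t => i (F t)) P2| <= e),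
      mHintegrable mu F <->
        (exists (G : T -> set X) (f : T -> X),
          [/\ forall t, cwk (G t), forall t w, 0 <= i (G t) w,
              mHintegrable mu G, Hintegrable mu f &
              forall t, F t = mink_add (G t) [set f t]]) &
      mHintegrable mu F -> support_family_ui mu F].
Proof.
have mH_iff := mHintegrable_emb T_compact T_borel mu i_emb F_cwk.
split.
- exact: mH_iff.
- move=> J I FJ FI; apply: (Hintegral_unique T_compact T_borel FI).
  exact: ((mHintegral_emb mu i_emb J F_cwk).1 FJ).2.
- split=> [/mH_iff[I FI]|FC]; first exact: Hintegral_cauchy FI.
  apply/mH_iff/(Hintegrable_cauchy T_compact T_borel) => e e0.
  exact: FC measurableT e e0.
- split; first exact: (mHintegrable_decomposition T_compact T_borel i_emb F_cwk).
  move=> [G [f [cG _ /(mHintegrable_emb T_compact T_borel mu i_emb cG)[I GI] [x fx] FE]]].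
  apply/mH_iff; exists (I + i [set x]).
  have -> : (fun t => i (F t)) = (fun t => i (G t) + i [set f t]).
    by apply/funext => t; rewrite FE (embD i_emb)//; exact: cwk_set1.
  by apply: HintegralD => //; exact: Hintegral_emb_set1.
- exact: (mHintegrable_support_family_ui T_compact T_borel i_emb F_cwk).
Qed.
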